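(* Let $S$ be the curve $y(2x-y)(y+x^2)(y-x^2)=0$. Its local braid monodromy $\beta$ at $(0,0)$ is: the points $y=1,0,-1$ of the fiber over $x=1$ do two counterclockwise generalized full-twists, and the point $y=2$ does a counterclockwise full-twist around the points $y=1,0,-1$ together. That is, $\beta$ is the braid induced by the motion in which first $\{-1,0,1\}$ is rotated about $0$ by the angle $4\pi$ counterclockwise with $2$ fixed, and then $2$ makes one full counterclockwise revolution along the circle $|y|=2$ with $-1,0,1$ fixed. The induced relations are $$x_4x_3x_2x_1=x_3x_2x_1x_4,\qquad (x_3x_2x_1)^2x_4=x_2x_1x_3x_2x_1x_4x_3=x_1x_3x_2x_1x_4x_3x_2,$$ where $\{x_1,x_2,x_3,x_4\}$ are the generators of the standard g-base.
   Context: Let $E=\{x\in\mathbb{C}:|x|\le 1\}$, $D=\{y\in\mathbb{C}:|y|\le 4\}$, and regard $S$ as a curve in $E\times D$. The projection of $S$ to $E$ has fibers of constant cardinality $n$ ($n=4$ here) except over $x=0$. Let $K\subset D$ be the set of $y$-coordinates of the points of $S$ over $x=1$. A motion of $K$ in $D$ consists of $n$ continuous functions $m_i:[0,1]\to D$ with $m_i(t)\ne m_j(t)$ for all $t$ and $i\neq j$, and $\{m_i(0)\}=\{m_i(1)\}=K$. It is realized by a continuous family of diffeomorphisms $D_t$ of $D$, $D_0=\mathrm{Id}$, equal to the identity on $\partial D$, with $D_t(m_i(0))=m_i(t)$; the braid induced by the motion is the class of $D_1$ in the braid group $B_n[D,K]$, the group of diffeomorphisms of $D$ preserving $K$ and equal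 to the identity on $\partial D$, two being identified if they induce the same automorphism of $\pi_1(D-K,u_0)$. The local braid monodromy $\beta$ of $S$ at $(0,0)$ is the braid induced by the motion formed by the points of $S$ over $x=e^{2\pi i t}$, $0\le t\le 1$. Standard g-base: take the base point $u_0=-4i$ and let $p_1<\dots<p_n$ be the (real) points of $K$. The loop $x_i$ goes from $u_0$ along the straight segment to near $p_i$, once counterclockwise around $p_i$ on a small circle, and back. In a product of loops the left factor is traversed first. The group $\pi_1(D-K,u_0)$ is free on $x_1,\dots,x_n$. The relations induced by $\beta$ are $\beta(x_j)=x_j$, $j=1,\dots,n$. Saying that ''the induced relations are $R$'' means that $R$ and $\{\beta(x_j)=x_j\}_j$ have the same normal closure in the free group on $x_1,\dots,x_n$. *)

(* Defs.v *)
From Stdlib Require Export Reals Lra Lia List.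
From Coquelicot Require Export Coquelicot.
Export ListNotations.
Open Scope R_scope.

(** * The curve and the discs *)

Definition E (x : C) : Prop := Cmod x <= 1.
Definition D (y : C) : Prop := Cmod y <= 4.
Definition bdD (y : C) : Prop := Cmod y = 4.
Definition u0 : C := (0, -4).

Definition cis (a : R) : C := (cos a, sin a).

Definition curve (x y : C) : Prop :=
  E x /\ D y /\ (y * (2 * x - y) * (y + x ^ 2) * (y - x ^ 2) = 0)%C.

Definition fiber (S : C -> C -> Prop) (x : C) : C -> Prop := S x.

Definition K : C -> Prop := fiber curve 1.

(** The points of [K] in increasing order: [pt 1 = -1], [pt 2 = 0],
    [pt 3 = 1], [pt 4 = 2]. *)
Definition pt (i : nat) : R := INR i - 2.

Lemma K_pt (y : C) :
  K y <-> exists i, (1 <= i <= 4)%nat /\ y = RtoC (pt i).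
Proof.
assert (HD : forall r, -1 <= r <= 2 -> D (RtoC r)).
{ intros r Hr. unfold D. rewrite Cmod_R. apply Rabs_le. lra. }
split.
- intros [_ [_ H]].
  assert (Hz : forall a b : C, (a * b = 0)%C -> a = 0 \/ b = 0).
  { intros a b Hab. destruct (Ceq_dec a 0) as [Ha|Ha]; [now left|right].
    destruct (Ceq_dec b 0) as [Hb|Hb]; [easy|].
    exfalso. now apply (Cmult_neq_0 a b). }
  unfold pt.
  destruct (Hz _ _ H) as [H1|H1]; [destruct (Hz _ _ H1) as [H2|H2];
    [destruct (Hz _ _ H2) as [H3|H3]|]|].
  + exists 2%nat. split; [lia|]. rewrite H3. f_equal. simpl. ring.
  + exists 4%nat. split; [lia|]. simpl.
    replace (1 + 1 + 1 + 1 - 2) with 2 by ring.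
    replace y with (2 * 1 - (2 * 1 - y))%C by ring. rewrite H3. ring.
  + exists 1%nat. split; [lia|]. simpl.
    replace (1 - 2) with (-1) by ring.
    replace y with ((y + 1 ^ 2) - 1)%C by ring. rewrite H2.
    apply injective_projections; simpl; ring.
  + exists 3%nat. split; [lia|]. simpl.
    replace (1 + 1 + 1 - 2) with 1 by ring.
    replace y with ((y - 1 ^ 2) + 1)%C by ring. rewrite H1. ring.
- intros [i [Hi ->]]. split; [|split].
  + unfold E. rewrite Cmod_R, Rabs_R1. lra.
  + apply HD. unfold pt.
    assert (1 <= INR i <= 4).
    { split; [apply (le_INR 1)|replace 4 with (INR 4) by (simpl; ring);
        apply le_INR]; lia. }
    lra.
  + unfold pt.
    destruct i as [|[|[|[|[|i]]]]]; try lia; simpl INR;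
      apply injective_projections; simpl; ring.
Qed.

(** * Loops and the fundamental group

    A path is a function on [R] of which only the restriction to [[0,1]]
    matters.  The fundamental group of [X] at [u] is the set of loops in [X]
    at [u] modulo [homotopic X u]. *)

Definition I01 (t : R) : Prop := 0 <= t <= 1.

Definition path := R -> C.

Definition is_loop (X : C -> Prop) (u : C) (g : path) : Prop :=
  continuous_on I01 g /\ (forall t, I01 t -> X (g t)) /\ g 0 = u /\ g 1 = u.

Definition homotopic (X : C -> Prop) (u : C) (g h : path) : Prop :=
  exists H : R * R -> C,
    continuous_on (fun q : R * R => I01 (fst q) /\ I01 (snd q)) H /\
    (forall s t, I01 s -> I01 t -> X (H (s, t))) /\
    (forall t, I01 t -> H (0, t) = g t) /\
    (forall t, I01 t -> H (1, t) = h t) /\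
    (forall s, I01 s -> H (s, 0) = u /\ H (s, 1) = u).

(** [g ** h] traverses [g] first. *)
Definition concat (g h : path) : path :=
  fun t => if Rle_dec t (1 / 2) then g (2 * t) else h (2 * t - 1).

Notation "g ** h" := (concat g h) (at level 40, left associativity).

Definition reverse (g : path) : path := fun t => g (1 - t).

(** The normal closure in the fundamental group of the elements [l * r^-1],
    for all the equations [l = r] in [Eq], as a set of loops that is a union
    of homotopy classes. *)
Inductive normal_closure (X : C -> Prop) (u : C) (Eq : path -> path -> Prop) :
    path -> Prop :=
| nc_relator l r : Eq l r -> normal_closure X u Eq (l ** reverse r)
| nc_one : normal_closure X u Eq (fun _ => u)
| nc_mul g h : normal_closure X u Eq g -> normal_closure X u Eq h ->
    normal_closure X u Eq (g ** h)
| nc_inv g : normal_closure X u Eq g -> normal_closure X u Eq (reverse g)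
| nc_conj a g : is_loop X u a -> normal_closure X u Eq g ->
    normal_closure X u Eq (a ** g ** reverse a)
| nc_homotopic g h : normal_closure X u Eq g -> homotopic X u g h ->
    normal_closure X u Eq h.

Definition same_normal_closure (X : C -> Prop) (u : C)
    (Eq1 Eq2 : path -> path -> Prop) : Prop :=
  forall g, is_loop X u g ->
    (normal_closure X u Eq1 g <-> normal_closure X u Eq2 g).

(** * Diffeomorphisms of [D] and the braid group [B_n[D,K]] *)

(** [f] is infinitely differentiable on the open set [U] as a function of two
    real variables. *)
Definition smooth_open (U : C -> Prop) (f : C -> C) : Prop :=
  forall x y : R, U (x, y) -> forall n : nat,
    ex_diff_n (fun a b => fst (f (a, b))) n x y /\
    ex_diff_n (fun a b => snd (f (a, b))) n x y.

(** On an arbitrary subset of the plane, smoothness means the local existence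
    of smooth extensions; this is needed at the boundary points of [D]. *)
Definition smooth_on (X : C -> Prop) (f : C -> C) : Prop :=
  forall z : C, X z -> exists (U : C -> Prop) (F : C -> C),
    open U /\ U z /\ smooth_open U F /\
    (forall w, U w -> X w -> F w = f w).

Definition diffeo_D (f : C -> C) : Prop :=
  smooth_on D f /\ (forall y, D y -> D (f y)) /\
  exists g : C -> C,
    smooth_on D g /\ (forall y, D y -> D (g y)) /\
    (forall y, D y -> g (f y) = y) /\ (forall y, D y -> f (g y) = y).

Definition fixes_bdD (f : C -> C) : Prop := forall y, bdD y -> f y = y.

Definition complement (L : C -> Prop) (y : C) : Prop := D y /\ ~ L y.

Definition act (f : C -> C) (g : path) : path := fun t => f (g t).

Definition braid_diffeo (L : C -> Prop) (f : C -> C) : Prop :=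
  diffeo_D f /\ fixes_bdD f /\
  (forall y, L y <-> exists z, L z /\ f z = y).

Definition same_automorphism (L : C -> Prop) (f g : C -> C) : Prop :=
  forall c, is_loop (complement L) u0 c ->
    homotopic (complement L) u0 (act f c) (act g c).

(** The set of diffeomorphisms [B] is an element of the braid group of
    [(D, L)]. *)
Definition is_braid (L : C -> Prop) (B : (C -> C) -> Prop) : Prop :=
  exists f, braid_diffeo L f /\
    forall g, B g <-> braid_diffeo L g /\ same_automorphism L f g.

(** * Motions *)

(** The [n] functions of a motion are [m 1], ..., [m n]. *)
Definition is_motion (L : C -> Prop) (n : nat) (m : nat -> R -> C) : Prop :=
  (forall i, (1 <= i <= n)%nat ->
     continuous_on I01 (m i) /\ forall t, I01 t -> D (m i t)) /\
  (forall i j t, (1 <= i <= n)%nat -> (1 <= j <= n)%nat -> i <> j -> I01 t ->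
     m i t <> m j t) /\
  (forall y, L y <-> exists i, (1 <= i <= n)%nat /\ m i 0 = y) /\
  (forall y, L y <-> exists i, (1 <= i <= n)%nat /\ m i 1 = y).

Definition realizes (n : nat) (m : nat -> R -> C) (F : R -> C -> C) : Prop :=
  continuous_on (fun q : R * C => I01 (fst q) /\ D (snd q))
    (fun q : R * C => F (fst q) (snd q)) /\
  (forall t, I01 t -> diffeo_D (F t) /\ fixes_bdD (F t)) /\
  (forall y, D y -> F 0 y = y) /\
  (forall i t, (1 <= i <= n)%nat -> I01 t -> F t (m i 0) = m i t).

(** The braid induced by a motion, as the set of its representatives. *)
Definition motion_braid (L : C -> Prop) (n : nat) (m : nat -> R -> C)
    (f : C -> C) : Prop :=
  is_motion L n m /\ braid_diffeo L f /\
  exists F, realizes n m F /\ same_automorphism L (F 1) f.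

Definition fiber_motion (S : C -> C -> Prop) (n : nat) (m : nat -> R -> C) :
    Prop :=
  forall t, I01 t -> forall y,
    fiber S (cis (2 * PI * t)) y <-> exists i, (1 <= i <= n)%nat /\ m i t = y.

Definition local_braid_monodromy (S : C -> C -> Prop) (n : nat)
    (f : C -> C) : Prop :=
  exists m, fiber_motion S n m /\ motion_braid (fiber S 1) n m f.

(** For [t <= 1/2] the points [-1, 0, 1] are rotated about [0] by the angle
    [4 * PI]; for [t >= 1/2] the point [2] makes one revolution about [0]. *)
Definition twist_motion (i : nat) (t : R) : C :=
  if Rle_dec t (1 / 2) then
    if Nat.eqb i 4 then RtoC (pt 4)
    else (RtoC (pt i) * cis (4 * PI * (2 * t)))%C
  else
    if Nat.eqb i 4 then (RtoC (pt 4) * cis (2 * PI * (2 * t - 1)))%C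
    else RtoC (pt i).

(** * The standard g-base and the induced relations *)

Definition segment (a b : C) : path := fun t => (a + t * (b - a))%C.

Definition circle (c q : C) : path :=
  fun t => (c + (q - c) * cis (2 * PI * t))%C.

(** The point at distance [eps] from [p] on the segment from [u0] to [p]. *)
Definition near_pt (eps : R) (p : C) : C :=
  (p + (eps / Cmod (u0 - p))%R * (u0 - p))%C.

Definition gbase_loop (eps : R) (p : C) : path :=
  segment u0 (near_pt eps p) ** circle p (near_pt eps p)
    ** segment (near_pt eps p) u0.

Definition induced_relations (n : nat) (x : nat -> path) (f : C -> C)
    (l r : path) : Prop :=
  exists j, (1 <= j <= n)%nat /\ l = act f (x j) /\ r = x j.

(* Main.v *)
From Stdlib Require Import Setoid Morphisms.
Require Import Defs.

(** Over [x = exp (2 pi i t)] the curve has the points [0], [x^2], [-x^2], [2x]: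
    the points at distance [1] from the origin turn by [4 pi] in total, the
    point at distance [2] by [2 pi].  Both motions of the theorem are therefore
    realized by maps [y |-> y cis (a L1(|y|^2) + b L2(|y|^2))], where [L1] and
    [L2] are interpolation polynomials and [(a, b)] depends on time, and both
    end in the same map, called [twist], with [(a, b) = (4 pi, 2 pi)].  Any two
    isotopies realizing a motion induce the same automorphism, so the monodromy
    is the class of [twist].

    Let [B] be the counterclockwise loop along [|y| = 4] and [A] the loop once
    around [-1, 0, 1], so that [A = x3 x2 x1] and [B = x4 A].  Unwinding the
    angles linearly, which is possible without meeting a point of [K] as long
    as the angles on the circles [|y| = 1] and [|y| = 2] do not change where the
    loop crosses them, shows that [twist] maps [x4] to [B x4 B^-1] and [xj] to
    [(B A) xj (B A)^-1] for [j <= 3].  Modulo [x4 A = A x4] one has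
    [B A = A^2 x4], and the induced relations say that [A^2 x4] commutes with
    [x1], [x2] and [x3]. *)

(** * Continuity *)

(** The obstacle is that a loop around -1, 0 or 1 based at [u0] crosses |y| = 2, where the twist
    turns by 2 pi, as well as the circle |y| = 1 or its inside, where 4 pi is wanted; no single
    constant angle suits both. Such loops are therefore cut at [bot], on |y| = 3/2, and the
    interpolation takes the value 4 pi there so that the twist fixes [bot]. The tail from [u0] to
    [bot] is compared with the angle 2 pi, the rest with 4 pi; the tracks of [u0] and [bot] during
    the first comparison are the sources of B and A. Between the nodes the polynomials may take any
    values: only the circles carrying points of K, the two base points and the boundary matter, and
    0 is fixed by every rotation. Polynomials instead of cut-off functions reduce smoothness to
    closed expressions in sin and cos. All polygonal homotopies are chains of filled triangles
    avoiding K, so they become linear arithmetic on explicit coordinates. *)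

Section Continuity.
Context {T : UniformSpace} (A : T -> Prop).

Lemma cont_comp {U V : UniformSpace} (B : U -> Prop) (f : T -> U) (g : U -> V) :
  continuous_on A f -> (forall x, A x -> B (f x)) -> continuous_on B g ->
  continuous_on A (fun x => g (f x)).
Proof.
intros Hf HAB Hg x Hx.
apply filterlim_comp with (2 := Hg _ (HAB _ Hx)).
intros P HP. specialize (Hf x Hx _ HP).
revert Hf. unfold filtermap, within. apply filter_imp. intuition.
Qed.

Lemma cont_const {U : UniformSpace} (c : U) : continuous_on A (fun _ => c).
Proof. intros x _. apply filterlim_const. Qed.

Lemma cont_id : continuous_on A (fun x => x).
Proof. apply continuous_on_forall. intros x _. apply filterlim_id. Qed.

Lemma cont_pair {U V : UniformSpace} (f : T -> U) (g : T -> V) :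
  continuous_on A f -> continuous_on A g ->
  continuous_on A (fun x => (f x, g x)).
Proof.
intros Hf Hg x Hx.
assert (H := filterlim_pair f g (Hf x Hx) (Hg x Hx)).
revert H. apply filterlim_filter_le_2.
intros P [eps HP]. exists (ball (f x) eps) (ball (g x) eps).
- apply locally_ball.
- apply locally_ball.
- intros u v Hu Hv. now apply HP.
Qed.

Lemma cont_fst {U V : UniformSpace} (f : T -> U * V) :
  continuous_on A f -> continuous_on A (fun x => fst (f x)).
Proof.
intros Hf. apply (cont_comp (fun _ => True) f fst); auto.
apply continuous_on_forall. intros x _. apply continuous_fst.
Qed.

Lemma cont_snd {U V : UniformSpace} (f : T -> U * V) :
  continuous_on A f -> continuous_on A (fun x => snd (f x)).
Proof.
intros Hf. apply (cont_comp (fun _ => True) f snd); auto.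
apply continuous_on_forall. intros x _. apply continuous_snd.
Qed.

Lemma cont_real (h : R -> R) (f : T -> R) :
  continuity h -> continuous_on A f -> continuous_on A (fun x => h (f x)).
Proof.
intros Hh Hf. apply (cont_comp (fun _ => True) f h); auto.
apply continuous_on_forall. intros x _. apply continuity_pt_filterlim, Hh.
Qed.

Lemma cont_Rplus (f g : T -> R) :
  continuous_on A f -> continuous_on A g -> continuous_on A (fun x => f x + g x).
Proof.
intros Hf Hg x Hx.
apply (filterlim_comp_2 f g Rplus (Hf x Hx) (Hg x Hx)).
exact (filterlim_plus (f x) (g x)).
Qed.

Lemma cont_Rmult (f g : T -> R) :
  continuous_on A f -> continuous_on A g -> continuous_on A (fun x => f x * g x).
Proof.
intros Hf Hg x Hx.
apply (filterlim_comp_2 f g Rmult (Hf x Hx) (Hg x Hx)).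
exact (filterlim_mult (f x) (g x)).
Qed.

Lemma cont_Ropp (f : T -> R) :
  continuous_on A f -> continuous_on A (fun x => - f x).
Proof. apply (cont_real Ropp). apply continuity_opp, derivable_continuous, derivable_id. Qed.

Lemma cont_Rminus (f g : T -> R) :
  continuous_on A f -> continuous_on A g -> continuous_on A (fun x => f x - g x).
Proof. intros Hf Hg. now apply cont_Rplus, cont_Ropp. Qed.

Lemma cont_pow (n : nat) (f : T -> R) :
  continuous_on A f -> continuous_on A (fun x => f x ^ n).
Proof. apply (cont_real (fun r => r ^ n)), derivable_continuous, derivable_pow. Qed.

Lemma cont_Rmin (f g : T -> R) :
  continuous_on A f -> continuous_on A g -> continuous_on A (fun x => Rmin (f x) (g x)).
Proof.
intros Hf Hg.
apply continuous_on_ext with (fun x => (f x + g x - Rabs (f x - g x)) * / 2).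
- intros x _. unfold Rmin, Rabs. destruct Rle_dec, Rcase_abs; lra.
- apply cont_Rmult, cont_const. apply cont_Rminus. now apply cont_Rplus.
  apply (cont_real Rabs). apply Rcontinuity_abs. now apply cont_Rminus.
Qed.

Lemma cont_Rmax (f g : T -> R) :
  continuous_on A f -> continuous_on A g -> continuous_on A (fun x => Rmax (f x) (g x)).
Proof.
intros Hf Hg.
apply continuous_on_ext with (fun x => - Rmin (- f x) (- g x)).
- intros x _. now rewrite <- Ropp_Rmax, Ropp_involutive.
- now apply cont_Ropp, cont_Rmin; apply cont_Ropp.
Qed.

Lemma cont_Cplus (f g : T -> C) :
  continuous_on A f -> continuous_on A g -> continuous_on A (fun x => (f x + g x)%C).
Proof.
intros Hf Hg. apply cont_pair; apply cont_Rplus;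
  solve [now apply (cont_fst (U := R_UniformSpace) (V := R_UniformSpace))
        |now apply (cont_snd (U := R_UniformSpace) (V := R_UniformSpace))].
Qed.

Lemma cont_Copp (f : T -> C) :
  continuous_on A f -> continuous_on A (fun x => (- f x)%C).
Proof.
intros Hf. apply cont_pair; apply cont_Ropp;
  solve [now apply (cont_fst (U := R_UniformSpace) (V := R_UniformSpace))
        |now apply (cont_snd (U := R_UniformSpace) (V := R_UniformSpace))].
Qed.

Lemma cont_Cminus (f g : T -> C) :
  continuous_on A f -> continuous_on A g -> continuous_on A (fun x => (f x - g x)%C).
Proof. intros Hf Hg. now apply cont_Cplus, cont_Copp. Qed.

Lemma cont_Cmult (f g : T -> C) :
  continuous_on A f -> continuous_on A g -> continuous_on A (fun x => (f x * g x)%C).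
Proof.
intros Hf Hg. apply cont_pair;
  [apply cont_Rminus|apply cont_Rplus]; apply cont_Rmult;
  solve [now apply (cont_fst (U := R_UniformSpace) (V := R_UniformSpace))
        |now apply (cont_snd (U := R_UniformSpace) (V := R_UniformSpace))].
Qed.

Lemma cont_RtoC (f : T -> R) :
  continuous_on A f -> continuous_on A (fun x => RtoC (f x)).
Proof. intros Hf. apply cont_pair; [exact Hf|apply cont_const]. Qed.

Lemma cont_cis (f : T -> R) :
  continuous_on A f -> continuous_on A (fun x => cis (f x)).
Proof.
intros Hf. apply cont_pair; apply cont_real;
  auto using continuity_cos, continuity_sin.
Qed.

Lemma cont_comp_pair {U : UniformSpace} (B : R * R -> Prop) (h : R * R -> U)
    (f g : T -> R) :
  continuous_on B h -> continuous_on A f -> continuous_on A g ->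
  (forall x, A x -> B (f x, g x)) -> continuous_on A (fun x => h (f x, g x)).
Proof.
intros Hh Hf Hg HB.
apply (cont_comp B (fun x => (f x, g x)) h); auto.
now apply (cont_pair (U := R_UniformSpace) (V := R_UniformSpace)).
Qed.

End Continuity.

(** Constant terms are recognized first, and eta-reduced functions are expanded again. Leaves such
    as [g (snd z)] are left to [assumption], which is why their continuity is asserted before each
    call. *)
Ltac cont :=
  lazymatch goal with
  | |- continuous_on _ (fun _ => ?c) => apply cont_const
  | |- continuous_on _ (fun x => x) => apply cont_id
  | |- continuous_on _ (@fst _ _) =>
      apply continuous_on_forall; intros; apply continuous_fst
  | |- continuous_on _ (@snd _ _) =>
      apply continuous_on_forall; intros; apply continuous_snd
  | |- continuous_on ?A (Rmult ?c) =>
      change (continuous_on A (fun x => c * x)); cont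
  | |- continuous_on ?A (Rplus ?c) =>
      change (continuous_on A (fun x => c + x)); cont
  | |- continuous_on ?A (Rminus ?c) =>
      change (continuous_on A (fun x => c - x)); cont
  | |- continuous_on ?A (Rmin ?c) =>
      change (continuous_on A (fun x => Rmin c x)); cont
  | |- continuous_on ?A RtoC =>
      change (continuous_on A (fun x => RtoC x)); cont
  | |- continuous_on _ (fun x => (_ + _)%C) => apply cont_Cplus; cont
  | |- continuous_on _ (fun x => (_ - _)%C) => apply cont_Cminus; cont
  | |- continuous_on _ (fun x => (- _)%C) => apply cont_Copp; cont
  | |- continuous_on _ (fun x => (_ * _)%C) => apply cont_Cmult; cont
  | |- continuous_on _ (fun x => RtoC _) => apply cont_RtoC; cont
  | |- continuous_on _ (fun x => cis _) => apply cont_cis; cont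
  | |- continuous_on _ (fun x => _ + _) => apply cont_Rplus; cont
  | |- continuous_on _ (fun x => _ - _) => apply cont_Rminus; cont
  | |- continuous_on _ (fun x => - _) => apply cont_Ropp; cont
  | |- continuous_on _ (fun x => _ * _) => apply cont_Rmult; cont
  | |- continuous_on _ (fun x => _ / _) => apply cont_Rmult; cont
  | |- continuous_on _ (fun x => _ ^ _) => apply cont_pow; cont
  | |- continuous_on _ (fun x => Rmin _ _) => apply cont_Rmin; cont
  | |- continuous_on _ (fun x => Rmax _ _) => apply cont_Rmax; cont
  | |- continuous_on _ (fun x => (_, _)) => apply cont_pair; cont
  | |- continuous_on _ (fun x => @fst R R _) =>
      apply (cont_fst _ (U := R_UniformSpace) (V := R_UniformSpace)); cont
  | |- continuous_on _ (fun x => @snd R R _) =>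
      apply (cont_snd _ (U := R_UniformSpace) (V := R_UniformSpace)); cont
  | |- continuous_on _ (fun x => @fst R (R * R) _) =>
      apply (cont_fst _ (U := R_UniformSpace) (V := C_UniformSpace)); cont
  | |- continuous_on _ (fun x => @snd R (R * R) _) =>
      apply (cont_snd _ (U := R_UniformSpace) (V := C_UniformSpace)); cont
  | |- continuous_on _ (fun x => @fst R C _) =>
      apply (cont_fst _ (U := R_UniformSpace) (V := C_UniformSpace)); cont
  | |- continuous_on _ (fun x => @snd R C _) =>
      apply (cont_snd _ (U := R_UniformSpace) (V := C_UniformSpace)); cont
  | |- _ => try assumption
  end.

(** * Paths up to homotopy *)

Section Groupoid.
Context {X : C -> Prop}.

Definition is_path (a b : C) (g : path) : Prop :=
  continuous_on I01 g /\ (forall t, I01 t -> X (g t)) /\ g 0 = a /\ g 1 = b.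

(** With [a = b = u] this is [homotopic X u] by conversion. Distinct ends are allowed because loops
    will be cut at intermediate points. *)
Definition phom (a b : C) (g h : path) : Prop :=
  exists H : R * R -> C,
    continuous_on (fun q : R * R => I01 (fst q) /\ I01 (snd q)) H /\
    (forall s t, I01 s -> I01 t -> X (H (s, t))) /\
    (forall t, I01 t -> H (0, t) = g t) /\
    (forall t, I01 t -> H (1, t) = h t) /\
    (forall s, I01 s -> H (s, 0) = a /\ H (s, 1) = b).

Lemma I01_0 : I01 0. Proof. unfold I01; lra. Qed.
Lemma I01_1 : I01 1. Proof. unfold I01; lra. Qed.

Definition convex (W : C -> Prop) : Prop :=
  forall z w s, W z -> W w -> I01 s -> W (RtoC (1 - s) * z + RtoC s * w)%C.

(** The straight-line homotopy in [W] is pushed forward by [Phi]. Reparametrizations, homotopies in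
    convex sets and the square lemma are its instances. *)
Lemma phom_image (W : C -> Prop) (Phi : C -> C) (p q : path) (a b : C) :
  convex W -> continuous_on W Phi -> (forall z, W z -> X (Phi z)) ->
  continuous_on I01 p -> continuous_on I01 q ->
  (forall t, I01 t -> W (p t)) -> (forall t, I01 t -> W (q t)) ->
  p 0 = q 0 -> p 1 = q 1 -> Phi (p 0) = a -> Phi (p 1) = b ->
  phom a b (fun t => Phi (p t)) (fun t => Phi (q t)).
Proof.
intros HW HPhi HX Hp Hq HpW HqW H0 H1 <- <-.
exists (fun z : R * R =>
  Phi (RtoC (1 - fst z) * p (snd z) + RtoC (fst z) * q (snd z))%C).
repeat split; simpl.
- apply cont_comp with (B := W) (g := Phi); auto.
  + assert (Hs : forall r : path, continuous_on I01 r -> continuous_on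
      (T := prod_UniformSpace R_UniformSpace R_UniformSpace)
      (fun z : R * R => I01 (fst z) /\ I01 (snd z)) (fun z => r (snd z))).
    { intros r Hr. apply cont_comp with (B := I01); auto; [cont|tauto]. }
    specialize (Hs p Hp) as Hp'. specialize (Hs q Hq) as Hq'. cont.
  + intros [s t] [Hs Ht]. apply HW; auto.
- intros s t Hs Ht. apply HX, HW; auto.
- intros t _. f_equal. rewrite Rminus_0_r. ring.
- intros t _. f_equal. rewrite Rminus_diag. ring.
- f_equal. rewrite <- H0, RtoC_minus. ring.
- f_equal. rewrite <- H1, RtoC_minus. ring.
Qed.

Lemma phom_is_path_l a b g h : phom a b g h -> is_path a b g.
Proof.
intros (H & Hc & HX & H0 & H1 & He). split; [|split; [|split]].
- apply continuous_on_ext with (fun t => H (0, t)); [auto|].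
  apply cont_comp_pair with (1 := Hc); [cont|cont|].
  intros t Ht. split; auto using I01_0.
- intros t Ht. rewrite <- H0; auto using I01_0.
- rewrite <- H0 by apply I01_0. now apply He, I01_0.
- rewrite <- H0 by apply I01_1. now apply He, I01_0.
Qed.

Lemma phom_refl a b g : is_path a b g -> phom a b g g.
Proof.
intros (Hc & HX & H0 & H1). exists (fun q => g (snd q)).
repeat split; simpl; auto.
apply cont_comp with (B := I01); auto; [cont|tauto].
Qed.

Lemma phom_sym a b g h : phom a b g h -> phom a b h g.
Proof.
intros (H & Hc & HX & H0 & H1 & He). exists (fun q => H (1 - fst q, snd q)).
assert (HI : forall s, I01 s -> I01 (1 - s)) by (unfold I01; intros; lra).
split; [|repeat split; simpl; intros; auto].
- apply cont_comp_pair with (1 := Hc); [cont|cont|].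
  intros [s t] [Hs Ht]; simpl in *; auto.
- now rewrite Rminus_0_r, H1.
- now rewrite Rminus_diag, H0.
- now apply He, HI.
- now apply He, HI.
Qed.

Lemma phom_is_path_r a b g h : phom a b g h -> is_path a b h.
Proof. intros H. now apply phom_is_path_l with g, phom_sym. Qed.

Lemma phom_ext a b g h : is_path a b g -> (forall t, I01 t -> g t = h t) ->
  phom a b g h.
Proof.
intros Hg He. destruct (phom_refl _ _ _ Hg) as (H & H1 & H2 & H3 & H4 & H5).
exists H. repeat split; auto; intros; try now apply H5.
rewrite H4 by easy. auto.
Qed.

Lemma Rmin_I01 t : I01 t -> I01 (Rmin (2 * t) 1).
Proof. unfold I01, Rmin. destruct Rle_dec; lra. Qed.

Lemma Rmax_I01 t : I01 t -> I01 (Rmax (2 * t - 1) 0).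
Proof. unfold I01, Rmax. destruct Rle_dec; lra. Qed.

(* Pasting without a case distinction: on each half of the interval one of the
   two terms is constant and cancels. *)
Lemma paste_eq (g h : path) t : g 1 = h 0 ->
  (g (Rmin (2 * t) 1) + h (Rmax (2 * t - 1) 0) - g 1)%C = (g ** h) t.
Proof.
intros E. unfold concat. destruct (Rle_dec t (1 / 2)).
- rewrite Rmin_left, Rmax_right by lra. rewrite <- E. ring.
- rewrite Rmin_right, Rmax_left by lra. ring.
Qed.

Lemma phom_trans a b f g h : phom a b f g -> phom a b g h -> phom a b f h.
Proof.
intros (H & Hc & HX & H0 & H1 & He) (H' & Hc' & HX' & H0' & H1' & He').
assert (Hg : continuous_on I01 g).
{ apply (phom_is_path_r a b f g). exists H; auto. }
pose (P := fun t => (fun s => H (s, t)) ** (fun s => H' (s, t))).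
assert (HP : forall s t, I01 t ->
  (H (Rmin (2 * s) 1, t) + H' (Rmax (2 * s - 1) 0, t) - g t)%C = P t s).
{ intros s t Ht. rewrite <- (H1 t Ht).
  apply (paste_eq (fun s => H (s, t)) (fun s => H' (s, t))).
  now rewrite H1, H0'. }
exists (fun q => P (snd q) (fst q)). split; [|repeat split; simpl].
- apply continuous_on_ext with (fun q : R * R =>
    (H (Rmin (2 * fst q) 1, snd q) + H' (Rmax (2 * fst q - 1) 0, snd q)
     - g (snd q))%C).
  { intros [s t] [_ Ht]. now apply HP. }
  assert (continuous_on (T := prod_UniformSpace R_UniformSpace R_UniformSpace)
    (fun q => I01 (fst q) /\ I01 (snd q))
    (fun q : R * R => H (Rmin (2 * fst q) 1, snd q))).
  { apply cont_comp_pair with (1 := Hc); [cont|cont|].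
    intros q [Hs Ht]; split; simpl; auto using Rmin_I01. }
  assert (continuous_on (T := prod_UniformSpace R_UniformSpace R_UniformSpace)
    (fun q => I01 (fst q) /\ I01 (snd q))
    (fun q : R * R => H' (Rmax (2 * fst q - 1) 0, snd q))).
  { apply cont_comp_pair with (1 := Hc'); [cont|cont|].
    intros q [Hs Ht]; split; simpl; auto using Rmax_I01. }
  assert (continuous_on (T := prod_UniformSpace R_UniformSpace R_UniformSpace)
    (fun q => I01 (fst q) /\ I01 (snd q)) (fun q : R * R => g (snd q))).
  { apply cont_comp with (B := I01); auto; [cont|tauto]. }
  cont.
- intros s t Hs Ht. unfold P, concat. destruct Rle_dec; unfold I01 in *;
    [apply HX|apply HX']; unfold I01; lra.
- intros t Ht. unfold P, concat. destruct Rle_dec; [|lra].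
  rewrite Rmult_0_r. auto.
- intros t Ht. unfold P, concat. destruct Rle_dec; [lra|].
  replace (2 * 1 - 1) with 1 by ring. auto.
- unfold P, concat. destruct Rle_dec; unfold I01 in *; [apply He|apply He'];
    unfold I01; lra.
- unfold P, concat. destruct Rle_dec; unfold I01 in *; [apply He|apply He'];
    unfold I01; lra.
Qed.

Lemma phom_concat a b c g g' h h' : phom a b g g' -> phom b c h h' ->
  phom a c (g ** h) (g' ** h').
Proof.
intros (H & Hc & HX & H0 & H1 & He) (H' & Hc' & HX' & H0' & H1' & He').
pose (P := fun s => (fun t => H (s, t)) ** (fun t => H' (s, t))).
assert (HP : forall s t, I01 s ->
  (H (s, Rmin (2 * t) 1) + H' (s, Rmax (2 * t - 1) 0) - b)%C = P s t).
{ intros s t Hs. replace b with (H (s, 1)) by now apply He.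
  apply (paste_eq (fun t => H (s, t)) (fun t => H' (s, t))).
  now rewrite (proj2 (He s Hs)), (proj1 (He' s Hs)). }
exists (fun q => P (fst q) (snd q)). split; [|repeat split; simpl].
- apply continuous_on_ext with (fun q : R * R =>
    (H (fst q, Rmin (2 * snd q) 1) + H' (fst q, Rmax (2 * snd q - 1) 0) - b)%C).
  { intros [s t] [Hs _]. now apply HP. }
  assert (continuous_on (T := prod_UniformSpace R_UniformSpace R_UniformSpace)
    (fun q => I01 (fst q) /\ I01 (snd q))
    (fun q : R * R => H (fst q, Rmin (2 * snd q) 1))).
  { apply cont_comp_pair with (1 := Hc); [cont|cont|].
    intros q [Hs Ht]; split; simpl; auto using Rmin_I01. }
  assert (continuous_on (T := prod_UniformSpace R_UniformSpace R_UniformSpace)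
    (fun q => I01 (fst q) /\ I01 (snd q))
    (fun q : R * R => H' (fst q, Rmax (2 * snd q - 1) 0))).
  { apply cont_comp_pair with (1 := Hc'); [cont|cont|].
    intros q [Hs Ht]; split; simpl; auto using Rmax_I01. }
  cont.
- intros s t Hs Ht. unfold P, concat. destruct Rle_dec; unfold I01 in *;
    [apply HX|apply HX']; unfold I01; lra.
- intros t Ht. unfold P, concat, I01 in *. destruct Rle_dec;
    [apply H0|apply H0']; lra.
- intros t Ht. unfold P, concat, I01 in *. destruct Rle_dec;
    [apply H1|apply H1']; lra.
- unfold P, concat. destruct Rle_dec; [|lra]. rewrite Rmult_0_r. now apply He.
- unfold P, concat. destruct Rle_dec; [lra|].
  replace (2 * 1 - 1) with 1 by ring. now apply He'.
Qed.

Lemma phom_reparam a b g phi psi : continuous_on I01 g ->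
  (forall t, I01 t -> X (g t)) ->
  continuous_on I01 phi -> continuous_on I01 psi ->
  (forall t, I01 t -> I01 (phi t)) -> (forall t, I01 t -> I01 (psi t)) ->
  phi 0 = psi 0 -> phi 1 = psi 1 -> g (phi 0) = a -> g (phi 1) = b ->
  phom a b (fun t => g (phi t)) (fun t => g (psi t)).
Proof.
intros Hg HX Hphi Hpsi Iphi Ipsi H0 H1 Ha Hb.
(* The parameter interval is thickened to a vertical strip of the plane, which is convex, so that
   parameters can be moved linearly. *)
apply (phom_image (fun z => I01 (fst z)) (fun z => g (fst z))
  (fun t => RtoC (phi t)) (fun t => RtoC (psi t))); simpl; auto.
- unfold convex, I01; simpl; intros z w s Hz Hw Hs.
  rewrite !Rmult_0_l, !Rminus_0_r. nra.
- apply cont_comp with (B := I01); auto. cont.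
- cont.
- cont.
- congruence.
- congruence.
Qed.

Lemma phom_reverse a b g h : phom a b g h -> phom b a (reverse g) (reverse h).
Proof.
intros (H & Hc & HX & H0 & H1 & He). exists (fun q => H (fst q, 1 - snd q)).
assert (HI : forall s, I01 s -> I01 (1 - s)) by (unfold I01; intros; lra).
split; [|repeat split; simpl; intros; auto].
- apply cont_comp_pair with (1 := Hc); [cont|cont|].
  intros [s t] [Hs Ht]; simpl in *; auto.
- now rewrite Rminus_0_r; apply He.
- now rewrite Rminus_diag; apply He.
Qed.

Lemma is_path_concat a b c g h : is_path a b g -> is_path b c h ->
  is_path a c (g ** h).
Proof.
intros Hg Hh. apply phom_is_path_l with (g ** h).
now apply phom_concat with b; apply phom_refl.
Qed.

Lemma is_path_reverse a b g : is_path a b g -> is_path b a (reverse g).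
Proof.
intros Hg. apply phom_is_path_l with (reverse g).
now apply phom_reverse, phom_refl.
Qed.

Lemma phom_assoc a b c d f g h :
  is_path a b f -> is_path b c g -> is_path c d h ->
  phom a d (f ** g ** h) (f ** (g ** h)).
Proof.
intros Hf Hg Hh.
assert (H : is_path a d (f ** (g ** h))) by
  eauto using is_path_concat.
assert (H' : is_path a d (f ** g ** h)) by
  eauto using is_path_concat.
(* The change of parameter has slopes 2, 1, 1/2 with breaks at 1/4 and 1/2; being concave, it is the
   minimum of its three affine pieces. *)
apply phom_trans with (fun t =>
  (f ** (g ** h)) (Rmin (Rmin (2 * t) (t + 1 / 4)) ((t + 1) / 2))).
- apply phom_ext; auto. intros t [Ht0 Ht1].
  destruct (Rle_dec t (1 / 4)) as [H4|H4];
    [|destruct (Rle_dec t (1 / 2)) as [H2|H2]].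
  + rewrite !Rmin_left by (try rewrite Rmin_left; lra). unfold concat.
    destruct (Rle_dec t (1 / 2)); [|lra].
    destruct (Rle_dec (2 * t) (1 / 2)); [|lra]. easy.
  + rewrite Rmin_left, Rmin_right by (try rewrite Rmin_right; lra).
    unfold concat.
    destruct (Rle_dec t (1 / 2)); [|lra].
    destruct (Rle_dec (2 * t) (1 / 2)); [lra|].
    destruct (Rle_dec (t + 1 / 4) (1 / 2)); [lra|].
    destruct (Rle_dec (2 * (t + 1 / 4) - 1) (1 / 2)); [|lra].
    f_equal; field.
  + rewrite Rmin_right by (try rewrite Rmin_right; lra).
    unfold concat.
    destruct (Rle_dec t (1 / 2)); [lra|].
    destruct (Rle_dec ((t + 1) / 2) (1 / 2)); [lra|].
    destruct (Rle_dec (2 * ((t + 1) / 2) - 1) (1 / 2)); [lra|].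
    f_equal; field.
- destruct H as (Hc & HX & H0 & H1).
  assert (E0 : Rmin (Rmin (2 * 0) (0 + 1 / 4)) ((0 + 1) / 2) = 0).
  { rewrite !Rmin_left by (try rewrite Rmin_left; lra). ring. }
  assert (E1 : Rmin (Rmin (2 * 1) (1 + 1 / 4)) ((1 + 1) / 2) = 1).
  { rewrite Rmin_right by (try rewrite Rmin_right; lra). field. }
  apply (phom_reparam a d _ _ (fun t => t)); auto; try congruence.
  + cont.
  + cont.
  + intros t [Ht0 Ht1]. unfold I01.
    unfold Rmin. destruct (Rle_dec (2 * t) (t + 1 / 4)); destruct Rle_dec; lra.
Qed.

Lemma phom_unit_l a b g : is_path a b g -> phom a b ((fun _ => a) ** g) g.
Proof.
intros Hg. assert (Hg' := Hg). destruct Hg as (Hc & HX & H0 & H1).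
apply phom_sym, phom_trans with (fun t => g (Rmax (2 * t - 1) 0)).
- apply (phom_reparam a b g (fun t => t)); auto using Rmax_I01; try cont.
  + rewrite Rmax_right; lra.
  + rewrite Rmax_left; lra.
- apply phom_ext.
  + apply phom_is_path_r with g.
    apply (phom_reparam a b g (fun t => t)); auto using Rmax_I01; try cont.
    * rewrite Rmax_right; lra.
    * rewrite Rmax_left; lra.
  + intros t Ht. unfold concat. destruct Rle_dec.
    * now rewrite Rmax_right by lra.
    * now rewrite Rmax_left by lra.
Qed.

(** [g ** reverse g] is [g] after a tent function, and the tent is contracted to 0 inside the
    parameter interval. *)
Lemma phom_inv_r a b g : is_path a b g ->
  phom a a (g ** reverse g) (fun _ => a).
Proof.
intros Hg. assert (Hg' := is_path_concat _ _ _ _ _ Hg (is_path_reverse _ _ _ Hg)).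
destruct Hg as (Hc & HX & H0 & H1).
apply phom_trans with (fun t => g (Rmin (2 * t) (2 - 2 * t))).
- apply phom_ext; auto. intros t Ht. unfold concat, reverse.
  destruct Rle_dec; [rewrite Rmin_left by lra|rewrite Rmin_right by lra];
    f_equal; ring.
- subst a. apply (phom_reparam _ _ g _ (fun _ => 0)); auto using I01_0; try cont.
  + intros t [? ?]. unfold Rmin, I01. destruct Rle_dec; lra.
  + rewrite Rmin_left; lra.
  + rewrite Rmin_right; lra.
  + f_equal. rewrite Rmin_left; lra.
  + f_equal. rewrite Rmin_right; lra.
Qed.

Lemma phom_convex (W : C -> Prop) a b g h : convex W ->
  (forall z, W z -> X z) -> is_path a b g -> is_path a b h ->
  (forall t, I01 t -> W (g t)) -> (forall t, I01 t -> W (h t)) ->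
  phom a b g h.
Proof.
intros HW HX (Hg & _ & g0 & g1) (Hh & _ & h0 & h1) HgW HhW.
apply (phom_image W (fun z => z)); auto; try congruence. cont.
Qed.

(** The two routes along the boundary from (0,0) to (1,1) are joined linearly inside the unit
    square; clamped parameters describe each route by one formula. This is how circles slide along
    spokes and how the twist gets compared with a rotation. *)
Lemma phom_square (H : C -> C) :
  continuous_on (fun z => I01 (fst z) /\ I01 (snd z)) H ->
  (forall s t, I01 s -> I01 t -> X (H (s, t))) ->
  phom (H (0, 0)) (H (1, 1))
    ((fun t => H (0, t)) ** (fun s => H (s, 1)))
    ((fun s => H (s, 0)) ** (fun t => H (1, t))).
Proof.
intros Hc HX.
pose (p := fun t : R => (Rmax (2 * t - 1) 0, Rmin (2 * t) 1) : C).
pose (q := fun t : R => (Rmin (2 * t) 1, Rmax (2 * t - 1) 0) : C).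
assert (P : forall t, I01 t -> H (p t) =
   ((fun t => H (0, t)) ** (fun s => H (s, 1))) t).
{ intros t Ht. unfold p, concat. destruct Rle_dec.
  - now rewrite Rmin_left, Rmax_right by lra.
  - now rewrite Rmin_right, Rmax_left by lra. }
assert (Q : forall t, I01 t -> H (q t) =
   ((fun s => H (s, 0)) ** (fun t => H (1, t))) t).
{ intros t Ht. unfold q, concat. destruct Rle_dec.
  - now rewrite Rmin_left, Rmax_right by lra.
  - now rewrite Rmin_right, Rmax_left by lra. }
assert (PQ : phom (H (0, 0)) (H (1, 1)) (fun t => H (p t)) (fun t => H (q t))).
{ apply (phom_image (fun z => I01 (fst z) /\ I01 (snd z)) H); auto.
  - unfold convex, I01; simpl; intros z w s Hz Hw Hs.
    rewrite !Rmult_0_l, !Rminus_0_r, !Rplus_0_r. nra.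
  - intros [s t] [Hs Ht]. auto.
  - unfold p. cont.
  - unfold q. cont.
  - intros t Ht; unfold p; simpl; auto using Rmin_I01, Rmax_I01.
  - intros t Ht; unfold q; simpl; auto using Rmin_I01, Rmax_I01.
  - unfold p, q. rewrite Rmin_left, Rmax_right by lra.
    now rewrite Rmult_0_r.
  - unfold p, q. rewrite Rmin_right, Rmax_left by lra.
    f_equal; ring.
  - unfold p. rewrite Rmin_left, Rmax_right by lra.
    now rewrite Rmult_0_r.
  - unfold p. rewrite Rmin_right, Rmax_left by lra.
    do 2 f_equal; ring. }
apply phom_trans with (fun t => H (p t)).
- apply phom_sym, phom_ext; [|exact P]. now apply phom_is_path_l in PQ.
- apply phom_trans with (1 := PQ). apply phom_ext; [|exact Q].
  now apply phom_is_path_r in PQ.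
Qed.

End Groupoid.

(** * The fundamental groupoid, with rewriting modulo homotopy *)

Section HPath.
Context {X : C -> Prop}.

(** The ends are indices of the type and the path property is bundled, so that composability is
    settled by typing and homotopies can serve as rewriting rules. *)
Definition hpath (a b : C) : Type := {g : path | @is_path X a b g}.

Definition heq {a b : C} (p q : hpath a b) : Prop :=
  @phom X a b (proj1_sig p) (proj1_sig q).

Definition hcomp {a b c : C} (p : hpath a b) (q : hpath b c) : hpath a c :=
  exist _ _ (is_path_concat _ _ _ _ _ (proj2_sig p) (proj2_sig q)).

Definition hinv {a b : C} (p : hpath a b) : hpath b a :=
  exist _ _ (is_path_reverse _ _ _ (proj2_sig p)).

#[global] Instance heq_equiv a b : Equivalence (@heq a b).
Proof.
split.
- intros p. apply phom_refl, proj2_sig.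
- intros p q. apply phom_sym.
- intros p q r. apply phom_trans.
Qed.

#[global] Instance hcomp_proper a b c :
  Proper (heq ==> heq ==> heq) (@hcomp a b c).
Proof. intros p p' Hp q q' Hq. now apply phom_concat with b. Qed.

#[global] Instance hinv_proper a b : Proper (heq ==> heq) (@hinv a b).
Proof. intros p p' Hp. now apply phom_reverse. Qed.

End HPath.

Arguments hpath X a b : clear implicits.

Declare Scope hpath_scope.
Delimit Scope hpath_scope with hpath.
Open Scope hpath_scope.
Infix "≃" := heq (at level 70) : hpath_scope.
Infix "∙" := hcomp (at level 40, left associativity) : hpath_scope.
Notation "p ⁻¹" := (hinv p) (at level 2, format "p ⁻¹") : hpath_scope.

Section Laws.
Context {X : C -> Prop}.

Lemma heq_ext {a b : C} (p q : hpath X a b) :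
  (forall t, I01 t -> proj1_sig p t = proj1_sig q t) -> p ≃ q.
Proof. intros H. apply phom_ext; [apply proj2_sig|exact H]. Qed.

Lemma hassoc {a b c d : C} (p : hpath X a b) (q : hpath X b c) (r : hpath X c d) :
  p ∙ q ∙ r ≃ p ∙ (q ∙ r).
Proof. apply phom_assoc with b c; apply proj2_sig. Qed.

(** The unit is any loop that is constant on [0,1]: a canonical one would require a proof that [a]
    lies in [X]. *)
Lemma hconst_l {a b : C} (p : hpath X a a) (q : hpath X a b) :
  (forall t, I01 t -> proj1_sig p t = a) -> p ∙ q ≃ q.
Proof.
intros H. apply phom_trans with ((fun _ => a) ** proj1_sig q).
- apply phom_concat with a; apply phom_ext; auto; apply proj2_sig.
- apply phom_unit_l, proj2_sig.
Qed.

Lemma hinv_inv {a b : C} (p : hpath X a b) : p⁻¹⁻¹ ≃ p.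
Proof.
apply heq_ext. intros t _. simpl. unfold reverse. f_equal. ring.
Qed.

(** The tail [q] lets the law act inside right-associated products, and it absorbs the constant path
    left by [p ∙ p⁻¹]. *)
Lemma hcancel_r {a b c : C} (p : hpath X a b) (q : hpath X a c) :
  p ∙ (p⁻¹ ∙ q) ≃ q.
Proof.
rewrite <- hassoc.
apply phom_trans with ((fun _ => a) ** proj1_sig q).
- apply phom_concat with a; [|apply phom_refl, proj2_sig].
  apply phom_inv_r with b, proj2_sig.
- apply phom_unit_l, proj2_sig.
Qed.

Lemma hcancel_l {a b c : C} (p : hpath X a b) (q : hpath X b c) :
  p⁻¹ ∙ (p ∙ q) ≃ q.
Proof. rewrite <- (hinv_inv p) at 2. apply hcancel_r. Qed.

Lemma hinv_comp {a b c : C} (p : hpath X a b) (q : hpath X b c) :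
  (p ∙ q)⁻¹ ≃ q⁻¹ ∙ p⁻¹.
Proof.
apply heq_ext. intros t _. simpl. unfold reverse, concat.
destruct p as (f & ? & ? & ? & Hf), q as (g & ? & ? & Hg & ?); simpl.
(* Both tests succeed only at [t = 1/2], where the two sides are [f 1] and [g 0], the common end
   [b]. *)
destruct (Rle_dec (1 - t) (1 / 2)), (Rle_dec t (1 / 2)); try lra;
  try (f_equal; ring).
replace (2 * (1 - t)) with 1 by lra. replace (1 - 2 * t) with 0 by lra.
congruence.
Qed.

Lemma hcancel_end {a b c : C} (q : hpath X a b) (p : hpath X b c) :
  q ∙ (p ∙ p⁻¹) ≃ q.
Proof.
assert (E : (q ∙ (p ∙ p⁻¹))⁻¹ ≃ q⁻¹).
{ rewrite !hinv_comp, hassoc, hinv_inv. apply hcancel_r. }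
now rewrite <- (hinv_inv (q ∙ (p ∙ p⁻¹))), E, hinv_inv.
Qed.

(** * Polygons and circles *)

(** Barycentric coordinates are written in real components so that, for explicit vertices,
    membership is linear in the weights. *)
Definition in_hull (a b c z : C) : Prop :=
  exists l1 l2 l3, 0 <= l1 /\ 0 <= l2 /\ 0 <= l3 /\ l1 + l2 + l3 = 1 /\
    z = (l1 * fst a + l2 * fst b + l3 * fst c,
         l1 * snd a + l2 * snd b + l3 * snd c).

(** The degenerate case [tri a a b] expresses that a segment lies in [X], so edges and faces share
    one notion. *)
Definition tri (a b c : C) : Prop := forall z, in_hull a b c z -> X z.

Lemma in_hull_convex (a b c : C) : convex (in_hull a b c).
Proof.
intros z w s (k1 & k2 & k3 & K1 & K2 & K3 & K & ->)
  (l1 & l2 & l3 & L1 & L2 & L3 & L & ->) [Hs0 Hs1].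
exists ((1 - s) * k1 + s * l1), ((1 - s) * k2 + s * l2), ((1 - s) * k3 + s * l3).
repeat split; try nra.
apply injective_projections; simpl; ring.
Qed.

Lemma segment_in_hull a b c p q t : in_hull a b c p -> in_hull a b c q ->
  I01 t -> in_hull a b c (segment p q t).
Proof.
intros Hp Hq Ht. unfold segment.
replace (p + t * (q - p))%C with (RtoC (1 - t) * p + RtoC t * q)%C.
- now apply in_hull_convex.
- rewrite RtoC_minus. ring.
Qed.

Lemma in_hull_1 a b c : in_hull a b c a.
Proof. exists 1, 0, 0. repeat split; try lra. apply injective_projections; simpl; ring. Qed.
Lemma in_hull_2 a b c : in_hull a b c b.
Proof. exists 0, 1, 0. repeat split; try lra. apply injective_projections; simpl; ring. Qed.
Lemma in_hull_3 a b c : in_hull a b c c.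
Proof. exists 0, 0, 1. repeat split; try lra. apply injective_projections; simpl; ring. Qed.

Lemma segment_0 a b : segment a b 0 = a.
Proof. unfold segment. ring. Qed.
Lemma segment_1 a b : segment a b 1 = b.
Proof. unfold segment. ring. Qed.

Lemma segment_is_path a b : tri a a b -> @is_path X a b (segment a b).
Proof.
intros H. split; [|split; [|split]]; auto using segment_0, segment_1.
- unfold segment. cont.
- intros t Ht. apply H, segment_in_hull; auto using in_hull_1, in_hull_3.
Qed.

Definition hseg (a b : C) (H : tri a a b) : hpath X a b :=
  exist _ _ (segment_is_path a b H).

Lemma hseg_tri a b c Hab Hbc Hac : tri a b c ->
  hseg a b Hab ∙ hseg b c Hbc ≃ hseg a c Hac.
Proof.
intros H. apply phom_convex with (W := in_hull a b c); auto.
- apply in_hull_convex.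
- apply (proj2_sig (hseg a b Hab ∙ hseg b c Hbc)).
- apply (proj2_sig (hseg a c Hac)).
- intros t Ht. simpl. unfold concat. destruct Rle_dec;
    apply segment_in_hull; auto using in_hull_1, in_hull_2, in_hull_3;
    unfold I01 in *; lra.
- intros t Ht. simpl. apply segment_in_hull; auto using in_hull_1, in_hull_3.
Qed.

Lemma hseg_inv a b Hab Hba : (hseg a b Hab)⁻¹ ≃ hseg b a Hba.
Proof.
apply heq_ext. intros t _. simpl. unfold reverse, segment.
rewrite RtoC_minus. ring.
Qed.

Definition sqdist (z c : C) : R := (fst z - fst c) ^ 2 + (snd z - snd c) ^ 2.

(** The inner circle is the one inscribed in the square whose corners are the quarter turns of [q]
    about [c]; hence the annulus contains the sides of that square. *)
Definition annulus (c q z : C) : Prop :=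
  sqdist q c / 2 <= sqdist z c <= sqdist q c.

Definition corner (c q : C) (k : nat) : C := (c + (q - c) * Ci ^ k)%C.

Lemma circle_corner c q k : circle c q (INR k / 4) = corner c q k.
Proof.
unfold circle, corner. do 2 f_equal. unfold cis.
induction k as [|k IH].
- simpl INR. replace (2 * PI * (0 / 4)) with 0 by field.
  now rewrite cos_0, sin_0.
- rewrite S_INR. simpl Cpow. rewrite <- IH.
  replace (2 * PI * ((INR k + 1) / 4)) with (PI / 2 + 2 * PI * (INR k / 4))
    by field.
  rewrite cos_plus, sin_plus, cos_PI2, sin_PI2.
  apply injective_projections; simpl; ring.
Qed.

(* A quarter of the circle and its chord lie in a circular segment, which is
   convex and contained in the annulus. *)
Lemma quarter_circle c q k :
  (forall z, annulus c q z -> X z) ->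
  phom (X := X) (corner c q k) (corner c q (S k))
    (fun t => circle c q (INR k / 4 + t / 4))
    (segment (corner c q k) (corner c q (S k))).
Proof.
intros HX.
set (w := (corner c q k - c)%C).
set (r := fst w ^ 2 + snd w ^ 2).
assert (Ek : corner c q k = (c + w)%C) by (unfold w; ring).
assert (Ek' : corner c q (S k) = (c + w * Ci)%C)
  by (unfold w, corner; simpl Cpow; ring).
assert (Er : r = sqdist q c).
{ unfold r, w, corner. clear. induction k as [|k IH].
  - unfold sqdist. simpl. ring.
  - rewrite <- IH. simpl Cpow. simpl. ring. }
assert (Ea : forall t, circle c q (INR k / 4 + t / 4) = (c + w * cis (PI / 2 * t))%C).
{ intros t. unfold w. rewrite <- circle_corner. unfold circle.
  replace (2 * PI * (INR k / 4 + t / 4))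
    with (2 * PI * (INR k / 4) + PI / 2 * t) by field.
  unfold cis at 1. rewrite cos_plus, sin_plus.
  unfold cis. apply injective_projections; simpl; ring. }
clearbody w.
(* The vector [(fst w - snd w, fst w + snd w)] is [w + w * Ci]. Its inner product with both [w] and
   [w * Ci] is [r], so the second condition bounds the half-plane beyond the chord. *)
pose (W := fun z : C => sqdist z c <= r /\
  r <= (fst z - fst c) * (fst w - snd w) + (snd z - snd c) * (fst w + snd w)).
assert (WX : forall z, W z -> X z).
{ intros z [H1 H2]. apply HX. unfold annulus. rewrite <- Er. split; [|exact H1].
  unfold sqdist in *.
  set (x := fst z - fst c) in *. set (y := snd z - snd c) in *.
  (* Cauchy-Schwarz with |w + w i|^2 = 2 r; with the half-plane condition it gives r / 2 <= |z -
     c|^2. *)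
  assert (H3 : (x * (fst w - snd w) + y * (fst w + snd w)) ^ 2
    <= (x ^ 2 + y ^ 2) * (2 * r)).
  { unfold r. assert (0 <= (x * (fst w + snd w) - y * (fst w - snd w)) ^ 2)
      by apply pow2_ge_0. lra. }
  assert (0 <= r) by (unfold r; nra).
  destruct (Req_dec r 0) as [->|Hr]; nra. }
assert (Wseg : forall t, I01 t -> W (segment (corner c q k) (corner c q (S k)) t)).
{ intros t [Ht0 Ht1]. unfold W, sqdist, segment. rewrite Ek, Ek'. simpl.
  split; [|right; unfold r; ring].
  apply Rle_trans with (r - r * (2 * t * (1 - t))); [right; unfold r; ring|].
  assert (0 <= r * (2 * t * (1 - t))); [|lra].
  apply Rmult_le_pos; unfold r; nra. }
assert (Warc : forall t, I01 t -> W (circle c q (INR k / 4 + t / 4))).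
{ intros t [Ht0 Ht1]. rewrite Ea. unfold W, sqdist.
  assert (HPI := PI_RGT_0).
  assert (0 <= cos (PI / 2 * t)) by (apply cos_ge_0; nra).
  assert (0 <= sin (PI / 2 * t)) by (apply sin_ge_0; nra).
  assert (E := sin2_cos2 (PI / 2 * t)). unfold Rsqr in E.
  unfold cis. simpl.
  set (x := cos (PI / 2 * t)) in *. set (y := sin (PI / 2 * t)) in *.
  assert (1 <= x + y) by nra.
  replace (fst c + (fst w * x - snd w * y) - fst c) with
    (fst w * x - snd w * y) by ring.
  replace (snd c + (fst w * y + snd w * x) - snd c) with
    (fst w * y + snd w * x) by ring.
  split.
  - right. transitivity (r * (y * y + x * x)); [unfold r; ring|rewrite E; ring].
  - replace ((fst w * x - snd w * y) * (fst w - snd w) +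
      (fst w * y + snd w * x) * (fst w + snd w)) with (r * (x + y))
      by (unfold r; ring).
    assert (0 <= r) by (unfold r; nra). nra. }
apply phom_convex with (W := W); auto.
- intros z z' s [H1 H2] [H1' H2'] [Hs0 Hs1]. unfold W, sqdist in *. simpl.
  split; [|nra].
  set (x := fst z - fst c) in *. set (y := snd z - snd c) in *.
  set (x' := fst z' - fst c) in *. set (y' := snd z' - snd c) in *.
  replace ((1 - s) * fst z - 0 * snd z + (s * fst z' - 0 * snd z') - fst c)
    with ((1 - s) * x + s * x') by (unfold x, x'; ring).
  replace ((1 - s) * snd z + 0 * fst z + (s * snd z' + 0 * fst z') - snd c)
    with ((1 - s) * y + s * y') by (unfold y, y'; ring).
  assert (0 <= s * (1 - s) * ((x - x') ^ 2 + (y - y') ^ 2)).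
  { apply Rmult_le_pos; [nra|]. apply Rplus_le_le_0_compat; apply pow2_ge_0. }
  nra.
- split; [|split; [|split]]; auto.
  + unfold circle. cont.
  + rewrite <- circle_corner. f_equal. lra.
  + rewrite <- circle_corner. f_equal. rewrite S_INR. lra.
- split; [|split; [|split]]; auto using segment_0, segment_1.
  unfold segment. cont.
Qed.

Lemma circle_is_path c q : (forall z, annulus c q z -> X z) ->
  @is_path X q q (circle c q).
Proof.
intros HX. split; [|split; [|split]].
- unfold circle. cont.
- intros t _. apply HX. unfold annulus.
  replace (sqdist (circle c q t) c) with (sqdist q c).
  + assert (0 <= sqdist q c).
    { apply Rplus_le_le_0_compat; apply pow2_ge_0. }
    lra.
  + assert (E := sin2_cos2 (2 * PI * t)). unfold Rsqr in E.
    unfold circle, sqdist, cis. simpl.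
    set (x := cos (2 * PI * t)) in *. set (y := sin (2 * PI * t)) in *.
    transitivity (((fst q - fst c) ^ 2 + (snd q - snd c) ^ 2) * (y * y + x * x));
      [rewrite E; ring|ring].
- replace 0 with (INR 0 / 4) by (simpl; field). rewrite circle_corner.
  unfold corner. simpl. ring.
- replace 1 with (INR 4 / 4) by (simpl; field). rewrite circle_corner.
  unfold corner. apply injective_projections; simpl; ring.
Qed.

Definition hcircle c q (H : forall z, annulus c q z -> X z) : hpath X q q :=
  exist _ _ (circle_is_path c q H).

(** The bracketing follows the two successive halvings of [0,1], so that the circle is pointwise the
    product of its four quarters. The corners are variables with equations in order to accept
    explicit coordinates. *)
Lemma hcircle_square c q H p1 p2 p3 H0 H1 H2 H3 :
  p1 = corner c q 1 -> p2 = corner c q 2 -> p3 = corner c q 3 ->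
  hcircle c q H ≃ hseg q p1 H0 ∙ hseg p1 p2 H1 ∙ (hseg p2 p3 H2 ∙ hseg p3 q H3).
Proof.
intros E1 E2 E3. subst p1 p2 p3.
assert (E0 : corner c q 0 = q) by (unfold corner; simpl; ring).
assert (E4 : corner c q 4 = q)
  by (unfold corner; apply injective_projections; simpl; ring).
assert (Q := fun k => quarter_circle c q k H).
assert (Q0 := Q 0%nat). assert (Q3 := Q 3%nat). rewrite E0 in Q0. rewrite E4 in Q3.
eapply phom_trans; [|exact (phom_concat _ _ _ _ _ _ _
  (phom_concat _ _ _ _ _ _ _ Q0 (Q 1%nat))
  (phom_concat _ _ _ _ _ _ _ (Q 2%nat) Q3))].
apply phom_ext; [apply (proj2_sig (hcircle c q H))|].
intros t _. simpl. unfold concat.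
destruct (Rle_dec t (1 / 2)).
- destruct (Rle_dec (2 * t) (1 / 2)); f_equal; simpl; field.
- destruct (Rle_dec (2 * t - 1) (1 / 2)); f_equal; simpl; field.
Qed.

End Laws.

(** * The complement of [K] *)

Definition sqn (z : C) : R := fst z ^ 2 + snd z ^ 2.

Lemma D_sqn z : D z <-> sqn z <= 16.
Proof.
unfold D, Cmod, sqn. assert (0 <= fst z ^ 2 + snd z ^ 2) by nra.
replace 4 with (sqrt 16); [split; [apply sqrt_le_0; lra|apply sqrt_le_1_alt]|].
replace 16 with (4 * 4) by ring. apply sqrt_square. lra.
Qed.

Lemma K_coord z : K z <->
  snd z = 0 /\ (fst z = -1 \/ fst z = 0 \/ fst z = 1 \/ fst z = 2).
Proof.
rewrite K_pt. split.
- intros (i & Hi & ->). simpl. split; [easy|]. unfold pt.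
  destruct i as [|[|[|[|[|i]]]]]; try lia; simpl; lra.
- destruct z as [x y]. simpl. intros [-> [->|[->|[->| ->]]]];
    [exists 1%nat|exists 2%nat|exists 3%nat|exists 4%nat]; split; try lia;
    unfold pt, RtoC; f_equal; simpl; ring.
Qed.

Lemma convex_D : convex D.
Proof.
intros z w s Hz Hw [Hs0 Hs1]. rewrite D_sqn in *. unfold sqn in *. simpl.
(* This is the defect of convexity: (1-s)|z|^2 + s|w|^2 - |(1-s)z + sw|^2 = s(1-s)|z-w|^2. *)
assert (0 <= s * (1 - s) * ((fst z - fst w) ^ 2 + (snd z - snd w) ^ 2)).
{ apply Rmult_le_pos; [nra|]. apply Rplus_le_le_0_compat; apply pow2_ge_0. }
nra.
Qed.

Lemma D_hull a b c z : D a -> D b -> D c -> in_hull a b c z -> D z.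
Proof.
intros Ha Hb Hc (l1 & l2 & l3 & L1 & L2 & L3 & L & ->).
(* Otherwise the point is a combination of [a] and of a point between [b] and [c], whose weights are
   obtained by dividing by [1 - l1]. *)
destruct (Req_dec l1 1) as [E|E].
- assert (l2 = 0) by lra. assert (l3 = 0) by lra. subst.
  eapply eq_ind; [exact Ha|]. apply injective_projections; simpl; ring.
- assert (Hbc := convex_D b c (l3 / (1 - l1)) Hb Hc).
  assert (H := convex_D a _ (1 - l1) Ha (Hbc ltac:(
    split; [apply Rle_div_r|apply Rle_div_l]; lra)) ltac:(unfold I01; lra)).
  eapply eq_ind; [exact H|].
  replace l2 with (1 - l1 - l3) by lra.
  apply injective_projections; simpl; field; lra.
Qed.

Local Notation X := (complement K).

(** Since K is real, only the weights giving height 0 have to be examined. For explicit vertices the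
    hypothesis is linear and falls to [lra]. *)
Lemma tri_X a b c : D a -> D b -> D c ->
  (forall l1 l2 l3, 0 <= l1 -> 0 <= l2 -> 0 <= l3 -> l1 + l2 + l3 = 1 ->
    l1 * snd a + l2 * snd b + l3 * snd c = 0 ->
    ~ (l1 * fst a + l2 * fst b + l3 * fst c = -1 \/
       l1 * fst a + l2 * fst b + l3 * fst c = 0 \/
       l1 * fst a + l2 * fst b + l3 * fst c = 1 \/
       l1 * fst a + l2 * fst b + l3 * fst c = 2)) ->
  tri (X := X) a b c.
Proof.
intros Ha Hb Hc H z Hz. split; [now apply (D_hull a b c)|].
rewrite K_coord. destruct Hz as (l1 & l2 & l3 & L1 & L2 & L3 & L & ->).
intros [E1 E2]. now apply (H l1 l2 l3).
Qed.

Lemma tri_hull {Y : C -> Prop} a b c p q r : tri (X := Y) a b c ->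
  in_hull a b c p -> in_hull a b c q -> in_hull a b c r -> tri (X := Y) p q r.
Proof.
intros H (p1 & p2 & p3 & P1 & P2 & P3 & P & ->)
  (q1 & q2 & q3 & Q1 & Q2 & Q3 & Q & ->) (r1 & r2 & r3 & R1 & R2 & R3 & R & ->)
  z (l1 & l2 & l3 & L1 & L2 & L3 & L & ->).
apply H. exists (l1 * p1 + l2 * q1 + l3 * r1), (l1 * p2 + l2 * q2 + l3 * r2),
  (l1 * p3 + l2 * q3 + l3 * r3).
simpl. repeat split; try nra; try (f_equal; ring).
Qed.

Ltac tri_sub T :=
  apply (tri_hull _ _ _ _ _ _ T); auto using in_hull_1, in_hull_2, in_hull_3.

(* The region between the two loops is the union of the eight triangles. *)
Lemma lens {Y : C -> Prop} u b c d P0 P1 P2 P3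
    H1 H2 H3 H4 H5 H6 H7 H8 H9 H10 :
  tri (X := Y) u P0 P1 -> tri (X := Y) u c P1 -> tri (X := Y) c P1 P2 ->
  tri (X := Y) c b P2 -> tri (X := Y) b P2 d ->
  tri (X := Y) P2 d P3 -> tri (X := Y) d P3 u -> tri (X := Y) P3 P0 u ->
  hseg (X := Y) u P0 H1 ∙
    (hseg P0 P1 H2 ∙ hseg P1 P2 H3 ∙ (hseg P2 P3 H4 ∙ hseg P3 P0 H5)) ∙
    hseg P0 u H6
  ≃ hseg u c H7 ∙ hseg c b H8 ∙ (hseg u d H9 ∙ hseg d b H10)⁻¹.
Proof.
intros T1 T2 T3 T4 T5 T6 T7 T8.
assert (uP1 : tri (X := Y) u u P1) by tri_sub T2.
assert (cP1 : tri (X := Y) c c P1) by tri_sub T2.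
assert (cP2 : tri (X := Y) c c P2) by tri_sub T3.
assert (bP2 : tri (X := Y) b b P2) by tri_sub T4.
assert (bd : tri (X := Y) b b d) by tri_sub T5.
assert (P2d : tri (X := Y) P2 P2 d) by tri_sub T5.
assert (dP3 : tri (X := Y) d d P3) by tri_sub T6.
assert (P3u : tri (X := Y) P3 P3 u) by tri_sub T7.
assert (du : tri (X := Y) d d u) by tri_sub T7.
rewrite hinv_comp, (hseg_inv d b _ bd), (hseg_inv u d _ du).
rewrite !hassoc, (hseg_tri P3 P0 u _ _ P3u T8).
rewrite <- (hassoc (hseg u P0 H1)), (hseg_tri u P0 P1 _ _ uP1 T1).
rewrite <- (hseg_tri u c P1 H7 cP1 uP1 T2), hassoc.
rewrite <- (hassoc (hseg c P1 cP1)), (hseg_tri c P1 P2 _ _ cP2 T3).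
rewrite <- (hseg_tri c b P2 H8 bP2 cP2 T4), hassoc.
rewrite <- (hseg_tri P2 d P3 P2d dP3 H4 T6), hassoc.
rewrite (hseg_tri d P3 u _ _ du T7).
rewrite <- (hassoc (hseg b P2 bP2)), (hseg_tri b P2 d _ _ bd T5).
reflexivity.
Qed.

(* [hup j] below runs from [u0] to [top] between the [j]-th and the [j+1]-st
   point of [K], so that the [i]-th generator is [hup i ∙ (hup (i - 1))⁻¹]. *)
Definition gap (j : nat) : C :=
  match j with
  | 0%nat => (-3/2, 0)
  | 1%nat => (-1/2, 0)
  | 2%nat => (1/2, 0)
  | 3%nat => (3/2, 0)
  | _ => (4, 0)
  end.

(** The points [bot], [gap 3], [top], [gap 0] are the corners of the square inscribed in |y| = 3/2,
    and [gap 4] is a corner of the one inscribed in |y| = 4. This is why both circles can be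
    expressed by the paths [hup]. *)
Definition top : C := (0, 3/2).
Definition bot : C := (0, -3/2).

Ltac tri_lra :=
  apply tri_X; [apply D_sqn; unfold sqn; simpl; lra..|simpl; intros; lra].

Lemma gap_lower j : tri (X := X) u0 u0 (gap j).
Proof. destruct j as [|[|[|[|j]]]]; tri_lra. Qed.

Lemma gap_upper j : tri (X := X) (gap j) (gap j) top.
Proof. destruct j as [|[|[|[|j]]]]; tri_lra. Qed.

Definition hup (j : nat) : hpath X u0 top :=
  hseg u0 (gap j) (gap_lower j) ∙ hseg (gap j) top (gap_upper j).

(** * The generators of the g-base in terms of the paths [hup] *)

Definition spoke (p : C) (k : R) : C := (p + RtoC k * (u0 - p))%C.

(** [k ^ 2 * (pt i ^ 2 + 16)] is the squared outer radius. Distinct points of K are at distance at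
    least 1, and the annulus omits its centre. *)
Lemma spoke_annulus i k : (1 <= i <= 4)%nat -> 0 < k ->
  k ^ 2 * (pt i ^ 2 + 16) < 1 ->
  forall z, annulus (RtoC (pt i)) (spoke (RtoC (pt i)) k) z -> X z.
Proof.
intros Hi Hk H z Hz. unfold annulus, sqdist, spoke in Hz. simpl in Hz.
assert (Hp : pt i = -1 \/ pt i = 0 \/ pt i = 1 \/ pt i = 2).
{ unfold pt. destruct i as [|[|[|[|[|i]]]]]; try lia; simpl; lra. }
set (r := pt i) in *. clearbody r.
set (d := (fst z - r) * ((fst z - r) * 1) + (snd z - 0) * ((snd z - 0) * 1)) in *.
assert (Hd : 0 < d < 1).
{ assert (0 < k ^ 2 * (r ^ 2 + 16)).
  { apply Rmult_lt_0_compat; [|nra]. now apply pow_lt. }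
  lra. }
split.
- apply D_sqn. unfold sqn. unfold d in Hd.
  assert (r ^ 2 <= 4) by (destruct Hp as [->|[->|[->| ->]]]; lra).
  (* The two squares yield |z|^2 <= 2 |z - r|^2 + 2 r^2 < 10. *)
  assert (0 <= (fst z - 2 * r) ^ 2) by apply pow2_ge_0.
  assert (0 <= snd z ^ 2) by apply pow2_ge_0. lra.
- rewrite K_coord. unfold d in Hd.
  intros [E1 E2]. rewrite E1 in Hd.
  destruct E2 as [E|[E|[E|E]]], Hp as [->|[->|[->| ->]]]; rewrite E in Hd; lra.
Qed.

Lemma spoke_hull i k1 k2 k3 : (1 <= i <= 4)%nat ->
  0 < k1 <= 1 -> 0 < k2 <= 1 -> 0 < k3 <= 1 ->
  let p := RtoC (pt i) in tri (X := X) (spoke p k1) (spoke p k2) (spoke p k3).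
Proof.
intros Hi H1 H2 H3 p.
assert (HD : forall k, 0 < k <= 1 -> D (spoke p k)).
{ intros k Hk. unfold spoke.
  replace (p + k * (u0 - p))%C with (RtoC (1 - k) * p + RtoC k * u0)%C
    by (rewrite RtoC_minus; ring).
  apply convex_D; [| |unfold I01; lra].
  - assert (Kp : K p) by (apply K_pt; eauto). apply Kp.
  - apply D_sqn. unfold sqn, u0. simpl. lra. }
apply tri_X; auto. unfold spoke, p. simpl.
intros l1 l2 l3 L1 L2 L3 L E. exfalso.
assert (E' : l1 * k1 + l2 * k2 + l3 * k3 = 0) by lra.
assert (0 <= l1 * k1) by (apply Rmult_le_pos; lra).
assert (0 <= l2 * k2) by (apply Rmult_le_pos; lra).
assert (0 <= l3 * k3) by (apply Rmult_le_pos; lra).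
assert (Hz : forall l k, 0 < k -> l * k = 0 -> l = 0).
{ intros l k Hk Hlk. apply Rmult_integral in Hlk. lra. }
assert (l1 = 0) by (apply Hz with k1; lra).
assert (l2 = 0) by (apply Hz with k2; lra).
assert (l3 = 0) by (apply Hz with k3; lra).
lra.
Qed.

(** The circles through the points of the spoke between [k] and [k'] sweep the image of a square.
    Convexity of squaring keeps all their radii below 1, hence away from K. *)
Lemma circle_slide i k k' Hc Hc' Hs : (1 <= i <= 4)%nat ->
  0 < k -> k ^ 2 * (pt i ^ 2 + 16) < 1 ->
  0 < k' -> k' ^ 2 * (pt i ^ 2 + 16) < 1 ->
  let p := RtoC (pt i) in
  hcircle p (spoke p k) Hc ∙ hseg (X := X) (spoke p k) (spoke p k') Hs
  ≃ hseg (spoke p k) (spoke p k') Hs ∙ hcircle p (spoke p k') Hc'.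
Proof.
intros Hi H1 H2 H3 H4 p.
pose (n := segment (spoke p k) (spoke p k')).
pose (H := fun z : C => circle p (n (fst z)) (snd z)).
assert (n0 : n 0 = spoke p k) by apply segment_0.
assert (n1 : n 1 = spoke p k') by apply segment_1.
assert (c0 : forall q, circle p q 0 = q).
{ intros q. unfold circle, cis. rewrite Rmult_0_r, cos_0, sin_0.
  apply injective_projections; simpl; ring. }
assert (c1 : forall q, circle p q 1 = q).
{ intros q. unfold circle, cis. rewrite Rmult_1_r, cos_2PI, sin_2PI.
  apply injective_projections; simpl; ring. }
assert (P := phom_square (X := X) H).
assert (P' : phom (X := X) (H (0, 0)) (H (1, 1))
         ((fun t : R => H (0, t)) ** (fun s : R => H (s, 1)))
         ((fun s : R => H (s, 0)) ** (fun t : R => H (1, t)))).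
{ apply P.
  - unfold H, circle, n, segment. cont.
  - intros s t Hs' Ht. unfold H. simpl.
    assert (Ek : n s = spoke p ((1 - s) * k + s * k')).
    { unfold n, segment, spoke. apply injective_projections; simpl; ring. }
    unfold I01 in Hs'.
    assert (S : forall z, annulus p (n s) z -> X z).
    { rewrite Ek. apply spoke_annulus; auto.
      - assert (0 <= (1 - s) * k) by (apply Rmult_le_pos; lra).
        destruct (Req_dec s 0) as [->|]; [lra|].
        assert (0 < s * k') by (apply Rmult_lt_0_compat; lra). lra.
      - assert (((1 - s) * k + s * k') ^ 2 <= (1 - s) * k ^ 2 + s * k' ^ 2).
        { assert (0 <= s * (1 - s) * (k - k') ^ 2); [|lra].
          apply Rmult_le_pos; [nra|apply pow2_ge_0]. }
        assert (0 <= pt i ^ 2) by apply pow2_ge_0.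
        apply Rle_lt_trans with (((1 - s) * k ^ 2 + s * k' ^ 2) * (pt i ^ 2 + 16)).
        + apply Rmult_le_compat_r; lra.
        + destruct (Req_dec s 0) as [->|]; [lra|].
          assert (s * (k' ^ 2 * (pt i ^ 2 + 16)) < s * 1)
            by (apply Rmult_lt_compat_l; lra).
          assert ((1 - s) * (k ^ 2 * (pt i ^ 2 + 16)) <= (1 - s) * 1)
            by (apply Rmult_le_compat_l; lra). lra. }
    apply (circle_is_path p (n s) S), Ht. }
unfold H in P' at 1 2. simpl in P'. rewrite c0, n0, c1, n1 in P'.
unfold heq.
eapply phom_trans; [|eapply phom_trans; [exact P'|]].
- apply phom_ext; [apply proj2_sig|]. intros t _. unfold H. simpl.
  unfold concat. destruct Rle_dec; [now rewrite n0|now rewrite c1].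
- apply phom_sym, phom_ext; [apply proj2_sig|]. intros t _. unfold H. simpl.
  unfold concat. destruct Rle_dec; [now rewrite c0|now rewrite n1].
Qed.

Lemma tri_refl_l {Y : C -> Prop} a b c : tri (X := Y) a b c -> tri (X := Y) a a b.
Proof. intros T. tri_sub T. Qed.
Lemma tri_refl_r {Y : C -> Prop} a b c : tri (X := Y) a b c -> tri (X := Y) b b c.
Proof. intros T. tri_sub T. Qed.
Lemma tri_diag {Y : C -> Prop} a b c : tri (X := Y) a b c -> tri (X := Y) a a c.
Proof. intros T. tri_sub T. Qed.

(** [P0] is the point at 1/10 of the spoke and the other [P]s are its quarter turns about [p]. These
    coordinates are explicit, so after replacing the circle by its square the triangles of [lens],
    taken with [gap i], [top], [gap (i - 1)], are checked numerically. *)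
Lemma small_loop_hup i P0 P1 P2 P3 Hs Hc Hs' : (1 <= i <= 4)%nat ->
  let p := RtoC (pt i) in
  P0 = (9/10 * pt i, -4/10) -> P1 = (pt i + 4/10, - pt i / 10) ->
  P2 = (11/10 * pt i, 4/10) -> P3 = (pt i - 4/10, pt i / 10) ->
  hseg u0 P0 Hs ∙ hcircle p P0 Hc ∙ hseg P0 u0 Hs' ≃ hup i ∙ (hup (i - 1))⁻¹.
Proof.
intros Hi p E0 E1 E2 E3.
assert (T1 : tri (X := X) u0 P0 P1).
{ subst; destruct i as [|[|[|[|[|i]]]]]; try lia; unfold pt; tri_lra. }
assert (T2 : tri (X := X) u0 (gap i) P1).
{ subst; destruct i as [|[|[|[|[|i]]]]]; try lia; unfold pt; tri_lra. }
assert (T3 : tri (X := X) (gap i) P1 P2).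
{ subst; destruct i as [|[|[|[|[|i]]]]]; try lia; unfold pt; tri_lra. }
assert (T4 : tri (X := X) (gap i) top P2).
{ subst; destruct i as [|[|[|[|[|i]]]]]; try lia; unfold pt; tri_lra. }
assert (T5 : tri (X := X) top P2 (gap (i - 1))).
{ subst; destruct i as [|[|[|[|[|i]]]]]; try lia; unfold pt; tri_lra. }
assert (T6 : tri (X := X) P2 (gap (i - 1)) P3).
{ subst; destruct i as [|[|[|[|[|i]]]]]; try lia; unfold pt; tri_lra. }
assert (T7 : tri (X := X) (gap (i - 1)) P3 u0).
{ subst; destruct i as [|[|[|[|[|i]]]]]; try lia; unfold pt; tri_lra. }
assert (T8 : tri (X := X) P3 P0 u0).
{ subst; destruct i as [|[|[|[|[|i]]]]]; try lia; unfold pt; tri_lra. }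
assert (S1 := tri_refl_r _ _ _ T1). assert (S2 := tri_refl_r _ _ _ T3).
assert (S4 := tri_refl_l _ _ _ T8).
assert (S3 : tri (X := X) P2 P2 P3) by tri_sub T6.
rewrite (hcircle_square p P0 Hc P1 P2 P3 S1 S2 S3 S4).
- now apply lens.
- rewrite E0, E1. unfold corner, p. apply injective_projections; simpl; field.
- rewrite E0, E2. unfold corner, p. apply injective_projections; simpl; field.
- rewrite E0, E3. unfold corner, p. apply injective_projections; simpl; field.
Qed.

(** Sliding the small circle along the spoke replaces its radius by the one of [small_loop_hup],
    whatever [eps] is. *)
Lemma gbase_hup eps i : 0 < eps < 1 -> (1 <= i <= 4)%nat ->
  phom (X := X) u0 u0 (gbase_loop eps (RtoC (pt i)))
    (proj1_sig (hup i ∙ (hup (i - 1))⁻¹)).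
Proof.
intros He Hi. set (p := RtoC (pt i)). set (k := eps / Cmod (u0 - p)).
assert (Hm : Cmod (u0 - p) ^ 2 = pt i ^ 2 + 16).
{ unfold Cmod. rewrite pow2_sqrt; [simpl; ring|].
  apply Rplus_le_le_0_compat; apply pow2_ge_0. }
assert (Hm4 : 4 <= Cmod (u0 - p)).
{ assert (0 <= Cmod (u0 - p)) by apply Cmod_ge_0.
  assert (0 <= pt i ^ 2) by apply pow2_ge_0. nra. }
assert (Hk : 0 < k <= 1).
{ unfold k. split; [apply Rdiv_lt_0_compat; lra|].
  apply Rle_div_l; lra. }
assert (Hk2 : k ^ 2 * (pt i ^ 2 + 16) < 1).
{ rewrite <- Hm. unfold k. replace ((eps / Cmod (u0 - p)) ^ 2 * Cmod (u0 - p) ^ 2)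
    with (eps ^ 2) by (field; lra). nra. }
assert (Hp : -1 <= pt i <= 2).
{ unfold pt. destruct i as [|[|[|[|[|i']]]]]; try lia; simpl; lra. }
assert (Hk2' : (1 / 10) ^ 2 * (pt i ^ 2 + 16) < 1) by nra.
assert (Hc := spoke_annulus i k Hi (proj1 Hk) Hk2).
assert (Hc' := spoke_annulus i (1 / 10) Hi ltac:(lra) Hk2').
fold p in Hc, Hc'.
assert (Hu : spoke p 1 = u0) by (unfold spoke; ring).
assert (T := fun k1 k2 k3 => spoke_hull i k1 k2 k3 Hi). cbv zeta in T. fold p in T.
assert (T1 : tri (X := X) u0 (spoke p k) (spoke p (1 / 10)))
  by (rewrite <- Hu; apply T; lra).
assert (T2 : tri (X := X) (spoke p k) (spoke p (1 / 10)) u0)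
  by (rewrite <- Hu; apply T; lra).
assert (S1 := tri_refl_l _ _ _ T1). assert (S2 := tri_refl_r _ _ _ T1).
assert (S3 := tri_diag _ _ _ T1). assert (S4 := tri_diag _ _ _ T2).
assert (S5 := tri_refl_r _ _ _ T2).
(* By the choice of [k], [near_pt eps p] is [spoke p k] by conversion. *)
change (hseg u0 (spoke p k) S1 ∙ hcircle p (spoke p k) Hc
  ∙ hseg (spoke p k) u0 S4 ≃ hup i ∙ (hup (i - 1))⁻¹).
rewrite <- (hseg_tri _ _ _ S2 S5 S4 T2), <- hassoc.
assert (Sl := circle_slide i k (1 / 10) Hc Hc' S2 Hi (proj1 Hk) Hk2 ltac:(lra) Hk2').
cbv zeta in Sl. fold p in Sl.
rewrite (hassoc (hseg u0 _ S1)), Sl.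
rewrite <- hassoc, (hseg_tri _ _ _ S1 S2 S3 T1).
apply (small_loop_hup i _ (pt i + 4/10, - pt i / 10) (11/10 * pt i, 4/10)
  (pt i - 4/10, pt i / 10)); auto.
unfold spoke, p. apply injective_projections; simpl; field.
Qed.

(** * The circles |y| = 4 and |y| = 3/2 *)

Lemma annulus_big z : annulus 0 u0 z -> X z.
Proof.
unfold annulus, sqdist, u0. simpl. intros H. split.
- apply D_sqn. unfold sqn. lra.
- rewrite K_coord. intros [E1 E2]. rewrite E1 in H.
  destruct E2 as [E|[E|[E|E]]]; rewrite E in H; lra.
Qed.

(** The squared radii run from 9/8 to 9/4, strictly between the values 1 and 4 taken on K. *)
Lemma annulus_small z : annulus 0 bot z -> X z.
Proof.
unfold annulus, sqdist, bot. simpl. intros H. split.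
- apply D_sqn. unfold sqn. lra.
- rewrite K_coord. intros [E1 E2]. rewrite E1 in H.
  destruct E2 as [E|[E|[E|E]]]; rewrite E in H; lra.
Qed.

Definition hbig : hpath X u0 u0 := hcircle 0 u0 annulus_big.

Definition hsmall : hpath X bot bot := hcircle 0 bot annulus_small.

(** The first side of the inscribed square is the first leg of [hup 4]. The other three are pushed
    inwards across four triangles onto the polygon through [gap 4], [top], [gap 0] and [u0]. *)
Lemma hbig_hup : hbig ≃ hup 4 ∙ (hup 0)⁻¹.
Proof.
pose (P1 := (4, 0) : C). pose (P2 := (0, 4) : C). pose (P3 := (-4, 0) : C).
assert (S1 : tri (X := X) u0 u0 P1) by tri_lra.
assert (S2 : tri (X := X) P1 P1 P2) by tri_lra.
assert (S3 : tri (X := X) P2 P2 P3) by tri_lra.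
assert (S4 : tri (X := X) P3 P3 u0) by tri_lra.
assert (S5 : tri (X := X) top top P2) by tri_lra.
assert (S6 : tri (X := X) top top P3) by tri_lra.
assert (S7 : tri (X := X) P1 P1 top) by tri_lra.
assert (S8 : tri (X := X) top top (gap 0)) by tri_lra.
assert (S9 : tri (X := X) (gap 0) (gap 0) P3) by tri_lra.
assert (S10 : tri (X := X) (gap 0) (gap 0) u0) by tri_lra.
unfold hbig. rewrite (hcircle_square 0 u0 _ P1 P2 P3 S1 S2 S3 S4);
  try (unfold corner, u0, P1, P2, P3; apply injective_projections; simpl; ring).
rewrite <- (hseg_tri P1 top P2 S7 S5 S2) by tri_lra.
rewrite !hassoc, <- (hassoc (hseg top P2 S5)).
rewrite (hseg_tri top P2 P3 S5 S3 S6) by tri_lra.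
rewrite <- (hseg_tri top (gap 0) P3 S8 S9 S6) by tri_lra.
rewrite hassoc, (hseg_tri (gap 0) P3 u0 S9 S4 S10) by tri_lra.
unfold hup at 2. rewrite hinv_comp, (hseg_inv _ _ _ S8), (hseg_inv _ _ _ S10).
unfold hup. rewrite !hassoc.
repeat (apply hcomp_proper; [apply heq_ext; reflexivity|]).
reflexivity.
Qed.

Lemma bot_lower j : (j <= 3)%nat -> tri (X := X) u0 bot (gap j).
Proof. intros Hj. destruct j as [|[|[|[|j]]]]; try lia; tri_lra. Qed.

Lemma bot_path : tri (X := X) u0 u0 bot.
Proof. tri_lra. Qed.

Definition hdown : hpath X u0 bot := hseg u0 bot bot_path.

(** [hup j] without the tail [hdown]. It stays inside |y| < 2, where the twist can be compared with
    the rotation by 4 pi. *)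
Definition hup' j (Hj : (j <= 3)%nat) : hpath X bot top :=
  hseg bot (gap j) (tri_refl_r _ _ _ (bot_lower j Hj))
    ∙ hseg (gap j) top (gap_upper j).

Lemma hup_hup' j Hj : hup j ≃ hdown ∙ hup' j Hj.
Proof.
unfold hup', hup, hdown.
now rewrite <- hassoc, (hseg_tri _ _ _ _ _ (gap_lower j) (bot_lower j Hj)).
Qed.

Lemma hsmall_hup : hdown ∙ hsmall ∙ hdown⁻¹ ≃ hup 3 ∙ (hup 0)⁻¹.
Proof.
assert (H3 : (3 <= 3)%nat) by lia. assert (H0 : (0 <= 3)%nat) by lia.
rewrite (hup_hup' 3 H3), (hup_hup' 0 H0), hinv_comp, !hassoc.
rewrite <- (hassoc (hup' 3 H3)).
apply hcomp_proper; [reflexivity|apply hcomp_proper; [|reflexivity]].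
unfold hsmall, hup'.
assert (S3 : tri (X := X) top top (gap 0)) by tri_lra.
assert (S4 : tri (X := X) (gap 0) (gap 0) bot) by tri_lra.
rewrite hinv_comp, (hseg_inv _ _ _ S3), (hseg_inv _ _ _ S4).
apply hcircle_square;
  unfold corner, bot; apply injective_projections; simpl; field.
Qed.

(** * Smoothness *)

(** A class of functions closed under partial derivatives, so that differentiability of every order
    follows from that of order one. *)
Inductive sexp : Type :=
| SCst (r : R) | SX | SY | SAdd (e f : sexp) | SMul (e f : sexp)
| SSin (e : sexp) | SCos (e : sexp).

Fixpoint seval (e : sexp) (x y : R) : R :=
  match e with
  | SCst r => r
  | SX => x
  | SY => y
  | SAdd e f => seval e x y + seval f x y
  | SMul e f => seval e x y * seval f x y
  | SSin e => sin (seval e x y)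
  | SCos e => cos (seval e x y)
  end.

(* The partial derivative in the first variable for [dx = 1] and [dy = 0], in
   the second one for [dx = 0] and [dy = 1]. *)
Fixpoint sderiv (dx dy : R) (e : sexp) : sexp :=
  match e with
  | SCst _ => SCst 0
  | SX => SCst dx
  | SY => SCst dy
  | SAdd e f => SAdd (sderiv dx dy e) (sderiv dx dy f)
  | SMul e f => SAdd (SMul (sderiv dx dy e) f) (SMul e (sderiv dx dy f))
  | SSin e => SMul (sderiv dx dy e) (SCos e)
  | SCos e => SMul (sderiv dx dy e) (SMul (SCst (-1)) (SSin e))
  end.

(** Differentiating along a line of direction [(dx, dy)] lets a single induction serve both partial
    derivatives. *)
Lemma seval_derive (e : sexp) (dx dy x y t : R) :
  is_derive (fun s => seval e (x + dx * s) (y + dy * s)) t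
    (seval (sderiv dx dy e) (x + dx * t) (y + dy * t)).
Proof.
induction e as [r| | |e IHe f IHf|e IHe f IHf|e IHe|e IHe]; simpl.
- auto_derive; auto.
- auto_derive; auto. ring.
- auto_derive; auto. ring.
- apply (is_derive_plus _ _ _ _ _ IHe IHf).
- apply (is_derive_mult _ _ _ _ _ IHe IHf). intros; apply Rmult_comm.
- apply (is_derive_comp sin _ t _ _ (is_derive_sin _) IHe).
- replace (-1 * sin (seval e (x + dx * t) (y + dy * t)))
    with (- sin (seval e (x + dx * t) (y + dy * t))) by ring.
  apply (is_derive_comp cos _ t _ _ (is_derive_cos _) IHe).
Qed.

Lemma seval_derive_1 e x y :
  is_derive (fun z => seval e z y) x (seval (sderiv 1 0 e) x y).
Proof.
assert (H := seval_derive e 1 0 0 y x).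
rewrite Rplus_0_l, Rmult_1_l, Rmult_0_l, Rplus_0_r in H.
revert H. apply is_derive_ext. intros t. f_equal; ring.
Qed.

Lemma seval_derive_2 e x y :
  is_derive (fun z => seval e x z) y (seval (sderiv 0 1 e) x y).
Proof.
assert (H := seval_derive e 0 1 x 0 y).
rewrite Rplus_0_l, Rmult_1_l, Rmult_0_l, Rplus_0_r in H.
revert H. apply is_derive_ext. intros t. f_equal; ring.
Qed.

Lemma seval_continuity e x y : continuity_2d_pt (seval e) x y.
Proof.
induction e as [r| | |e IHe f IHf|e IHe f IHf|e IHe|e IHe]; simpl.
- apply continuity_2d_pt_const.
- apply continuity_2d_pt_id1.
- apply continuity_2d_pt_id2.
- now apply continuity_2d_pt_plus.
- now apply continuity_2d_pt_mult.
- apply continuity_1d_2d_pt_comp; auto. apply continuity_sin.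
- apply continuity_1d_2d_pt_comp; auto. apply continuity_cos.
Qed.

Lemma seval_ex_diff_n n e x y : ex_diff_n (seval e) n x y.
Proof.
revert e x y. induction n as [|n IH]; intros e x y; simpl;
  (split; [apply seval_continuity|]); auto.
split; [|split; [|split]].
- eexists. apply seval_derive_1.
- eexists. apply seval_derive_2.
- apply ex_diff_n_ext_loc with (seval (sderiv 1 0 e)); auto.
  exists (mkposreal 1 Rlt_0_1). intros u v _ _. symmetry.
  apply is_derive_unique, seval_derive_1.
- apply ex_diff_n_ext_loc with (seval (sderiv 0 1 e)); auto.
  exists (mkposreal 1 Rlt_0_1). intros u v _ _. symmetry.
  apply is_derive_unique, seval_derive_2.
Qed.

Lemma smooth_on_seval (Y : C -> Prop) (f : C -> C) (e1 e2 : sexp) :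
  (forall x y, f (x, y) = (seval e1 x y, seval e2 x y)) -> smooth_on Y f.
Proof.
intros H z _. exists (fun _ => True), f.
split; [apply open_true|split; [easy|split; [|easy]]].
intros x y _ n. split.
- apply ex_diff_n_ext_loc with (seval e1); [|apply seval_ex_diff_n].
  exists (mkposreal 1 Rlt_0_1). intros u v _ _. now rewrite H.
- apply ex_diff_n_ext_loc with (seval e2); [|apply seval_ex_diff_n].
  exists (mkposreal 1 Rlt_0_1). intros u v _ _. now rewrite H.
Qed.

(** * Spins *)

(* The Lagrange polynomials with the values [1, 1, 0, 0] and [0, 0, 1, 0] at the
   squared distances [1, 9/4, 4, 16] of [pt 1] and [pt 3], [bot], [pt 4], [u0]. *)
Definition lag1 (u : R) : R := (u - 4) * (u - 16) * (1/45 + 268/17325 * (u - 1)).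
Definition lag2 (u : R) : R := (u - 1) * (u - 9/4) * (u - 16) * (-1/63).

Definition angle (a b u : R) : R := a * lag1 u + b * lag2 u.

Definition spin (a b : R) (z : C) : C := (z * cis (angle a b (sqn z)))%C.

Lemma cis_plus a b : cis (a + b) = (cis a * cis b)%C.
Proof.
unfold cis. rewrite cos_plus, sin_plus.
apply injective_projections; simpl; ring.
Qed.

Lemma cis_0 : cis 0 = 1.
Proof. unfold cis. now rewrite cos_0, sin_0. Qed.

Lemma cis_2PI : cis (2 * PI) = 1.
Proof. unfold cis. now rewrite cos_2PI, sin_2PI. Qed.

Lemma cis_4PI : cis (4 * PI) = 1.
Proof.
replace (4 * PI) with (2 * PI + 2 * PI) by ring.
rewrite cis_plus, cis_2PI. ring.
Qed.

Lemma sqn_cis z a : sqn (z * cis a)%C = sqn z.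
Proof.
assert (E := sin2_cos2 a). unfold Rsqr in E. unfold sqn, cis. simpl.
set (x := cos a) in *. set (y := sin a) in *.
transitivity ((fst z ^ 2 + snd z ^ 2) * (y * y + x * x)); [ring|rewrite E; ring].
Qed.

Lemma D_cis z a : D z -> D (z * cis a)%C.
Proof. now rewrite !D_sqn, sqn_cis. Qed.

(** A rotation preserves [sqn], on which the angle depends, so angles add. In particular the inverse
    of a spin is a spin, hence smooth. *)
Lemma spin_spin a b a' b' z : spin a b (spin a' b' z) = spin (a + a') (b + b') z.
Proof.
unfold spin. rewrite sqn_cis.
replace (angle (a + a') (b + b') (sqn z))
  with (angle a' b' (sqn z) + angle a b (sqn z)) by (unfold angle; ring).
rewrite cis_plus. ring.
Qed.

Lemma spin_0 z : spin 0 0 z = z.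
Proof.
unfold spin. replace (angle 0 0 (sqn z)) with 0 by (unfold angle; ring).
rewrite cis_0. ring.
Qed.

Lemma spin_inv a b z : spin (- a) (- b) (spin a b z) = z.
Proof. rewrite spin_spin, !Rplus_opp_l. apply spin_0. Qed.

Lemma spin_inv' a b z : spin a b (spin (- a) (- b) z) = z.
Proof. rewrite spin_spin, !Rplus_opp_r. apply spin_0. Qed.

Lemma D_spin a b z : D z -> D (spin a b z).
Proof. apply D_cis. Qed.

Lemma angle_1 a b : angle a b 1 = a.
Proof. unfold angle, lag1, lag2. field. Qed.
Lemma angle_bot a b : angle a b (9 / 4) = a.
Proof. unfold angle, lag1, lag2. field. Qed.
Lemma angle_4 a b : angle a b 4 = b.
Proof. unfold angle, lag1, lag2. field. Qed.
Lemma angle_16 a b : angle a b 16 = 0.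
Proof. unfold angle, lag1, lag2. field. Qed.

Lemma spin_boundary a b z : sqn z = 16 -> spin a b z = z.
Proof. intros E. unfold spin. rewrite E, angle_16, cis_0. ring. Qed.

Lemma smooth_spin (Y : C -> Prop) a b : smooth_on Y (spin a b).
Proof.
pose (u := SAdd (SMul SX SX) (SMul SY SY)).
pose (m := fun r => SAdd u (SCst (- r))).
pose (th := SAdd
  (SMul (SCst a) (SMul (SMul (m 4) (m 16))
    (SAdd (SCst (1/45)) (SMul (SCst (268/17325)) (m 1)))))
  (SMul (SCst b) (SMul (SMul (SMul (m 1) (m (9/4))) (m 16)) (SCst (-1/63))))).
apply smooth_on_seval with
  (e1 := SAdd (SMul SX (SCos th)) (SMul (SCst (-1)) (SMul SY (SSin th))))
  (e2 := SAdd (SMul SX (SSin th)) (SMul SY (SCos th))).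
intros x y. simpl. unfold spin, cis.
assert (E : angle a b (sqn (x, y)) =
  a * ((x * x + y * y + - (4)) * (x * x + y * y + - (16)) *
    (1/45 + 268/17325 * (x * x + y * y + - (1)))) +
  b * ((x * x + y * y + - (1)) * (x * x + y * y + - (9/4)) *
    (x * x + y * y + - (16)) * (-1/63))).
{ unfold angle, lag1, lag2, sqn. simpl. field. }
rewrite E. apply injective_projections; simpl; ring.
Qed.

Lemma spin_diffeo a b : diffeo_D (spin a b).
Proof.
split; [apply smooth_spin|split; [intros y; apply D_spin|]].
exists (spin (- a) (- b)).
split; [apply smooth_spin|split; [intros y; apply D_spin|]].
split; intros y _; [apply spin_inv|apply spin_inv'].
Qed.

Lemma bdD_sqn z : bdD z -> sqn z = 16.
Proof.
unfold bdD. intros H.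
assert (E : Cmod z ^ 2 = sqn z) by apply Cmod2_alt.
rewrite <- E, H. ring.
Qed.

Lemma spin_fixes_bdD a b : fixes_bdD (spin a b).
Proof. intros y Hy. now apply spin_boundary, bdD_sqn. Qed.

Lemma u0_bdD : bdD u0.
Proof.
unfold bdD, u0, Cmod. simpl.
replace (0 * (0 * 1) + -4 * (-4 * 1)) with (4 * 4) by ring.
apply sqrt_square. lra.
Qed.

Lemma cont_spin {T : UniformSpace} (A : T -> Prop) (a b : T -> R) (f : T -> C) :
  continuous_on A a -> continuous_on A b -> continuous_on A f ->
  continuous_on A (fun x => spin (a x) (b x) (f x)).
Proof. intros Ha Hb Hf. unfold spin, angle, lag1, lag2, sqn. cont. Qed.

Lemma sqn_K y : K y -> sqn y = 0 \/ sqn y = 1 \/ sqn y = 4.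
Proof.
rewrite K_coord. unfold sqn. intros [-> [->|[->|[->| ->]]]]; lra.
Qed.

Lemma sqn_0 z : sqn z = 0 -> z = 0.
Proof.
unfold sqn. intros H. apply injective_projections; simpl; nra.
Qed.

(** * Motions by spins *)

Lemma spin_K y : K y -> spin (4 * PI) (2 * PI) y = y.
Proof.
intros Hy. destruct (sqn_K y Hy) as [E|[E|E]].
- rewrite (sqn_0 y E). unfold spin. ring.
- unfold spin. rewrite E, angle_1, cis_4PI. ring.
- unfold spin. rewrite E, angle_4, cis_2PI. ring.
Qed.

(** K is finite and real: a path that moved would take a value strictly between two points of K. *)
Lemma cont_K_const (g : path) : continuous_on I01 g ->
  (forall t, I01 t -> K (g t)) -> forall t, I01 t -> g t = g 0.
Proof.
intros Hc HK t Ht.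
(* Clamping extends the real part of [g] to a continuous function on the whole line, as the
   intermediate value theorem requires. *)
pose (h := fun s => fst (g (Rmax 0 (Rmin 1 s)))).
assert (Hcl : forall s, I01 (Rmax 0 (Rmin 1 s))).
{ intros s. unfold I01, Rmax, Rmin. destruct (Rle_dec 1 s); destruct Rle_dec; lra. }
assert (Hid : forall s, I01 s -> Rmax 0 (Rmin 1 s) = s).
{ intros s [? ?]. rewrite Rmin_right, Rmax_right; lra. }
assert (Hh : forall s, continuous h s).
{ intros s. apply (continuous_continuous_on (fun _ => True)).
  - now exists (mkposreal 1 Rlt_0_1).
  - unfold h.
    assert (continuous_on (fun _ : R => True) (fun s => g (Rmax 0 (Rmin 1 s)))).
    { apply cont_comp with (B := I01) (g := g); auto. cont. }
    cont. }
assert (HKh : forall s, h s = -1 \/ h s = 0 \/ h s = 1 \/ h s = 2).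
{ intros s. apply K_coord, HK, Hcl. }
assert (E : h t = h 0).
{ destruct (Req_dec (h t) (h 0)) as [|N]; auto. exfalso.
  assert (Hy : exists y, Rmin (h 0) (h t) <= y <= Rmax (h 0) (h t) /\
    y <> -1 /\ y <> 0 /\ y <> 1 /\ y <> 2).
  (* Distinct values of [h] are integers, so the smaller one plus 1/2 lies between them and is no
     value of [h]. *)
  { exists (Rmin (h 0) (h t) + 1 / 2). unfold Rmin, Rmax.
    destruct (Rle_dec (h 0) (h t));
    destruct (HKh 0) as [E|[E|[E|E]]], (HKh t) as [E'|[E'|[E'|E']]]; lra. }
  destruct Hy as (y & Hy & Hn).
  destruct (IVT_gen_consistent h 0 t y Hh Hy) as (s & _ & Hs).
  specialize (HKh s). lra. }
unfold h in E. rewrite !Hid in E by auto using I01_0.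
assert (K1 := proj1 (K_coord _) (HK t Ht)).
assert (K2 := proj1 (K_coord _) (HK 0 I01_0)).
apply injective_projections; [easy|]. destruct K1, K2. congruence.
Qed.

Section SpinMotion.
Context (m : nat -> R -> C) (alpha beta : R -> R)
  (alpha_cont : continuous_on I01 alpha) (beta_cont : continuous_on I01 beta)
  (alpha_0 : alpha 0 = 0) (beta_0 : beta 0 = 0)
  (alpha_1 : alpha 1 = 4 * PI) (beta_1 : beta 1 = 2 * PI)
  (m_spin : forall i t, (1 <= i <= 4)%nat -> I01 t ->
    m i t = spin (alpha t) (beta t) (m i 0)).

Lemma spin_realizes : realizes 4 m (fun t => spin (alpha t) (beta t)).
Proof.
split; [|split; [|split]].
- assert (forall a : R -> R, continuous_on I01 a ->
    continuous_on (T := prod_UniformSpace R_UniformSpace C_UniformSpace)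
    (fun q : R * C => I01 (fst q) /\ D (snd q)) (fun q : R * C => a (fst q))).
  { intros a Ha. apply cont_comp with (B := I01); auto; [cont|tauto]. }
  apply cont_spin; auto. cont.
- intros t _. split; [apply spin_diffeo|apply spin_fixes_bdD].
- intros y _. rewrite alpha_0, beta_0. apply spin_0.
- intros i t Hi Ht. now rewrite (m_spin i t).
Qed.

(* [spin_s⁻¹ ∘ F_s] fixes the points of [K]; composing it with [spin_1] gives
   a homotopy from [spin_1] to [F_1]. *)
Lemma spin_unique F : is_motion K 4 m -> realizes 4 m F ->
  same_automorphism K (F 1) (spin (alpha 1) (beta 1)).
Proof.
intros (_ & _ & HK & _) (Fc & Fd & F0 & Fm) c (Hc & HX & c0 & c1).
assert (Fu : forall s, I01 s -> F s u0 = u0).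
{ intros s Hs. apply (Fd s Hs), u0_bdD. }
assert (Su : forall a b, spin a b u0 = u0).
{ intros a b. apply spin_fixes_bdD, u0_bdD. }
change (phom (X := X) u0 u0 (act (F 1) c) (act (spin (alpha 1) (beta 1)) c)).
apply phom_sym.
exists (fun q => spin (alpha 1) (beta 1)
  (spin (- alpha (fst q)) (- beta (fst q)) (F (fst q) (c (snd q))))).
split; [|split; [|split; [|split]]].
- assert (forall a : R -> R, continuous_on I01 a ->
    continuous_on (T := prod_UniformSpace R_UniformSpace R_UniformSpace)
    (fun q : R * R => I01 (fst q) /\ I01 (snd q)) (fun q => a (fst q))).
  { intros a Ha. apply cont_comp with (B := I01); auto; [cont|tauto]. }
  apply cont_spin; [cont|cont|].
  apply cont_spin; [cont; auto|cont; auto|].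
  refine (cont_comp _ _ (fun q : R * R => (fst q, c (snd q))) _ _ _ Fc).
  + assert (continuous_on (T := prod_UniformSpace R_UniformSpace R_UniformSpace)
      (fun q : R * R => I01 (fst q) /\ I01 (snd q)) (fun q => c (snd q))).
    { apply cont_comp with (B := I01); auto; [cont|tauto]. }
    apply (cont_pair _ (U := R_UniformSpace) (V := C_UniformSpace)); [cont|easy].
  + intros [s t] [Hs Ht]. split; [easy|]. apply HX, Ht.
- intros s t Hs Ht. simpl.
  destruct (Fd s Hs) as [(_ & FD & g & _ & _ & gF & _) _].
  split; [apply D_spin, D_spin, FD, HX, Ht|].
  intros HKy. apply (HX t Ht).
  set (y := spin (- alpha s) _ _) in HKy.
  (* The final spin is injective and fixes K pointwise, so a point sent into K already lies in K. *)
  assert (Ey : y = spin (alpha 1) (beta 1) y).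
  { assert (E := HKy). rewrite alpha_1, beta_1 in E. apply spin_K in E.
    rewrite <- alpha_1, <- beta_1 in E.
    apply (f_equal (spin (- alpha 1) (- beta 1))) in E.
    rewrite !spin_inv in E. easy. }
  rewrite <- Ey in HKy.
  destruct (proj1 (HK y) HKy) as (i & Hi & Ei).
  (* [F s] sends [c t] to the position at time [s] of a moving point; injectivity of [F s] then puts
     [c t] in K. *)
  assert (Ec : F s (c t) = F s (m i 0)).
  { rewrite (Fm i s Hi Hs), (m_spin i s Hi Hs), Ei. unfold y.
    now rewrite spin_inv'. }
  apply (f_equal g) in Ec.
  assert (KD : forall z, K z -> D z) by (intros z Hz; apply Hz).
  rewrite !gF in Ec by (try apply HX, Ht; rewrite ?Ei; auto).
  now rewrite Ec, Ei.
- intros t Ht. simpl. rewrite alpha_0, beta_0, Ropp_0, spin_0, F0; [easy|].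
  apply HX, Ht.
- intros t Ht. simpl. now rewrite spin_inv'.
- intros s Hs. simpl. now rewrite c0, c1, Fu, !Su by easy.
Qed.

Lemma spin_motion : (forall i, (1 <= i <= 4)%nat -> m i 0 = RtoC (pt i)) ->
  is_motion K 4 m.
Proof.
intros Hm.
assert (HK : forall y, K y <-> exists i, (1 <= i <= 4)%nat /\ m i 0 = y).
{ intros y. rewrite K_pt. split; intros (i & Hi & E); exists i;
    specialize (Hm i Hi); split; congruence. }
split; [|split; [|split]]; auto.
- intros i Hi. split.
  + apply continuous_on_ext with (fun t => spin (alpha t) (beta t) (m i 0)).
    * intros t Ht. symmetry. auto.
    * apply cont_spin; auto. cont.
  + intros t Ht. rewrite m_spin by auto. apply D_spin.
    assert (Ki : K (m i 0)) by (apply HK; eauto). apply Ki.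
- intros i j t Hi Hj N Ht E. rewrite (m_spin i), (m_spin j) in E by auto.
  apply (f_equal (spin (- alpha t) (- beta t))) in E.
  rewrite !spin_inv, !Hm in E by auto. apply N.
  apply (f_equal fst) in E. simpl in E. unfold pt in E.
  apply INR_eq. lra.
- intros y. rewrite HK.
  split; intros (i & Hi & E); exists i; split; auto; rewrite <- E;
    [rewrite m_spin by auto using I01_1|
     symmetry; rewrite m_spin by auto using I01_1];
    rewrite alpha_1, beta_1; apply spin_K, HK; eauto.
Qed.

(** By [spin_unique] the realizing isotopy does not affect the class, and only the final angles
    remain. Motions with different time courses thus give the same set of diffeomorphisms. *)
Lemma motion_braid_spin (f : C -> C) : is_motion K 4 m ->
  motion_braid K 4 m f <->
  braid_diffeo K f /\ same_automorphism K (spin (4 * PI) (2 * PI)) f.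
Proof.
intros Hm. rewrite <- alpha_1, <- beta_1. split.
- intros (_ & Hf & F & HF & Hs). split; [easy|].
  intros c Hc.
  apply (phom_trans (X := X) u0 u0 _ (act (F 1) c)); [|now apply Hs].
  apply phom_sym. now apply (spin_unique F Hm HF).
- intros [Hf Hs]. split; [easy|split; [easy|]].
  exists (fun t => spin (alpha t) (beta t)). split; [apply spin_realizes|easy].
Qed.

End SpinMotion.

(** * The motion of the fiber and the motion by full-twists *)

Definition twist : C -> C := spin (4 * PI) (2 * PI).

Definition fiber_spin (i : nat) (t : R) : C :=
  spin (4 * PI * t) (2 * PI * t) (RtoC (pt i)).

Lemma fiber_spin_0 i : fiber_spin i 0 = RtoC (pt i).
Proof. unfold fiber_spin. rewrite !Rmult_0_r. apply spin_0. Qed.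

Lemma spin_R a b r : spin a b (RtoC r) = (RtoC r * cis (angle a b (r ^ 2)))%C.
Proof. unfold spin, sqn. simpl. do 3 f_equal. ring. Qed.

Lemma fiber_curve t y : fiber curve (cis (2 * PI * t)) y <->
  exists i, (1 <= i <= 4)%nat /\ fiber_spin i t = y.
Proof.
set (x := cis (2 * PI * t)).
assert (Ex : x = cis (angle (4 * PI * t) (2 * PI * t) 4)) by now rewrite angle_4.
assert (Ex2 : (x ^ 2)%C = cis (angle (4 * PI * t) (2 * PI * t) 1)).
{ rewrite angle_1. replace (4 * PI * t) with (2 * PI * t + 2 * PI * t) by ring.
  rewrite cis_plus. simpl. unfold x. ring. }
assert (E : forall i, (1 <= i <= 4)%nat -> fiber_spin i t =
  match i with 1%nat => - x ^ 2 | 2%nat => 0 | 3%nat => x ^ 2 | _ => 2 * x end%C).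
{ intros i Hi. unfold fiber_spin. rewrite spin_R. unfold pt.
  destruct i as [|[|[|[|[|i]]]]]; try lia; simpl INR.
  - replace (1 - 2) with (-1) by ring. replace ((-1) ^ 2) with 1 by ring.
    rewrite <- Ex2. apply injective_projections; simpl; ring.
  - replace (1 + 1 - 2) with 0 by ring. ring.
  - replace (1 + 1 + 1 - 2) with 1 by ring. replace (1 ^ 2) with 1 by ring.
    rewrite <- Ex2. ring.
  - replace (1 + 1 + 1 + 1 - 2) with 2 by ring. replace (2 ^ 2) with 4 by ring.
    now rewrite <- Ex. }
unfold fiber, curve. split.
- intros (_ & _ & H).
  assert (Hz : forall a b : C, (a * b = 0)%C -> a = 0 \/ b = 0).
  { intros a b Hab. destruct (Ceq_dec a 0) as [Ha|Ha]; [now left|right].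
    destruct (Ceq_dec b 0) as [Hb|Hb]; [easy|].
    exfalso. now apply (Cmult_neq_0 a b). }
  destruct (Hz _ _ H) as [H1|H1]; [destruct (Hz _ _ H1) as [H2|H2];
    [destruct (Hz _ _ H2) as [H3|H3]|]|].
  + exists 2%nat. split; [lia|]. now rewrite E by lia.
  + exists 4%nat. split; [lia|]. rewrite E by lia.
    replace y with (2 * x - (2 * x - y))%C by ring. rewrite H3. ring.
  + exists 1%nat. split; [lia|]. rewrite E by lia.
    replace y with ((y + x ^ 2) - x ^ 2)%C by ring. rewrite H2. ring.
  + exists 3%nat. split; [lia|]. rewrite E by lia.
    replace y with ((y - x ^ 2) + x ^ 2)%C by ring. rewrite H1. ring.
- intros (i & Hi & <-). split; [|split].
  + change (Cmod x <= 1). right. unfold x, cis, Cmod. simpl.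
    transitivity (sqrt 1); [f_equal|apply sqrt_1].
    rewrite !Rmult_1_r, Rplus_comm. apply sin2_cos2.
  + apply D_spin. assert (Ki : K (RtoC (pt i))) by (apply K_pt; eauto). apply Ki.
  + rewrite E by easy. destruct i as [|[|[|[|[|i]]]]]; try lia; ring.
Qed.

(** Only the fiber as a set is prescribed at each time. Undoing the spin turns each [m i] into a
    path in K, which is constant; this holds for every labelling of the points. *)
Lemma fiber_motion_spin m : fiber_motion curve 4 m -> is_motion K 4 m ->
  forall i t, (1 <= i <= 4)%nat -> I01 t ->
  m i t = spin (4 * PI * t) (2 * PI * t) (m i 0).
Proof.
intros Hf (Hc & _) i t Hi Ht. destruct (Hc i Hi) as [Hi' _].
pose (g := fun s : R => spin (- (4 * PI * s)) (- (2 * PI * s)) (m i s)).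
assert (E : g t = g 0).
{ apply cont_K_const; auto.
  - apply cont_spin; [cont|cont|auto].
  - intros s Hs.
    destruct (proj1 (fiber_curve s (m i s))) as (j & Hj & Ej).
    { apply Hf; eauto. }
    unfold g. rewrite <- Ej. unfold fiber_spin. rewrite spin_inv.
    apply K_pt. eauto. }
unfold g in E. rewrite !Rmult_0_r, Ropp_0, spin_0 in E.
now rewrite <- E, spin_inv'.
Qed.

Lemma local_monodromy_twist f : local_braid_monodromy curve 4 f <->
  braid_diffeo K f /\ same_automorphism K twist f.
Proof.
assert (Ha : continuous_on I01 (fun t => 4 * PI * t)) by cont.
assert (Hb : continuous_on I01 (fun t => 2 * PI * t)) by cont.
assert (B := fun m => motion_braid_spin m (fun t => 4 * PI * t)
  (fun t => 2 * PI * t) Ha Hb (Rmult_0_r _) (Rmult_0_r _)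
  (Rmult_1_r _) (Rmult_1_r _)).
split.
- intros (m & Hm & Hf). assert (Hmm := proj1 Hf).
  apply (B m); auto. now apply fiber_motion_spin.
- intros H. exists fiber_spin. split.
  + intros t Ht y. apply fiber_curve.
  + assert (Hs : forall i t, (1 <= i <= 4)%nat -> I01 t -> fiber_spin i t =
      spin (4 * PI * t) (2 * PI * t) (fiber_spin i 0)).
    { intros i t _ _. now rewrite fiber_spin_0. }
    apply (B fiber_spin); auto.
    apply (spin_motion _ (fun t => 4 * PI * t) (fun t => 2 * PI * t));
      auto using Rmult_1_r, fiber_spin_0.
Qed.

Lemma twist_motion_twist f : motion_braid K 4 twist_motion f <->
  braid_diffeo K f /\ same_automorphism K twist f.
Proof.
(* [alpha] runs in the first half and then rests at its final value, [beta] rests at 0 and runs in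
   the second half; the clamps make continuity immediate. *)
pose (alpha := fun t => 4 * PI * Rmin (2 * t) 1).
pose (beta := fun t => 2 * PI * Rmax (2 * t - 1) 0).
assert (Ha : continuous_on I01 alpha) by (unfold alpha; cont).
assert (Hb : continuous_on I01 beta) by (unfold beta; cont).
assert (Ha0 : alpha 0 = 0) by (unfold alpha; rewrite Rmin_left; lra).
assert (Hb0 : beta 0 = 0) by (unfold beta; rewrite Rmax_right; lra).
assert (Ha1 : alpha 1 = 4 * PI) by (unfold alpha; rewrite Rmin_right; lra).
assert (Hb1 : beta 1 = 2 * PI) by (unfold beta; rewrite Rmax_left; lra).
assert (H0 : forall i, (1 <= i <= 4)%nat -> twist_motion i 0 = RtoC (pt i)).
{ intros i _. unfold twist_motion. destruct Rle_dec; [|lra].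
  rewrite !Rmult_0_r, cis_0. destruct (Nat.eqb_spec i 4) as [->|]; [easy|ring]. }
assert (Hs : forall i t, (1 <= i <= 4)%nat -> I01 t ->
  twist_motion i t = spin (alpha t) (beta t) (twist_motion i 0)).
{ intros i t Hi Ht. rewrite H0 by easy. rewrite spin_R.
  (* For [i = 2] the angle at radius 0 is left unevaluated, since it only rotates the point 0. *)
  assert (E : angle (alpha t) (beta t) (pt i ^ 2) =
    if Nat.eqb i 2 then angle (alpha t) (beta t) 0
    else if Nat.eqb i 4 then beta t else alpha t).
  { unfold pt. destruct i as [|[|[|[|[|i]]]]]; try lia; simpl.
    - replace ((1 - 2) * ((1 - 2) * 1)) with 1 by ring. apply angle_1.
    - f_equal. ring.
    - replace ((1 + 1 + 1 - 2) * ((1 + 1 + 1 - 2) * 1)) with 1 by ring.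
      apply angle_1.
    - replace ((1 + 1 + 1 + 1 - 2) * ((1 + 1 + 1 + 1 - 2) * 1)) with 4 by ring.
      apply angle_4. }
  rewrite E. unfold twist_motion, alpha, beta.
  destruct (Nat.eqb_spec i 2) as [->|N].
  - replace (pt 2) with 0 by (unfold pt; simpl; ring). simpl Nat.eqb.
    destruct Rle_dec; ring.
  - destruct (Nat.eqb_spec i 4), (Rle_dec t (1 / 2)).
    + rewrite Rmax_right, Rmult_0_r, cis_0 by lra. subst. ring.
    + rewrite Rmax_left by lra. now subst.
    + now rewrite Rmin_left by lra.
    + rewrite Rmin_right, Rmult_1_r, cis_4PI by lra. ring. }
apply (motion_braid_spin _ alpha beta); auto.
now apply (spin_motion _ alpha beta).
Qed.

Lemma twist_braid_diffeo : braid_diffeo K twist.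
Proof.
split; [apply spin_diffeo|split; [apply spin_fixes_bdD|]].
intros y. split.
- intros Hy. exists y. split; [easy|now apply spin_K].
- intros (z & Hz & <-). unfold twist. now rewrite spin_K.
Qed.

(** * The action of the twist on loops *)

Lemma cis_X z th : (sqn z = 1 \/ sqn z = 4 -> cis th = 1) -> X z ->
  X (z * cis th)%C.
Proof.
intros H [HD HK]. split; [now apply D_cis|].
intros HKc. apply HK. destruct (sqn_K _ HKc) as [E|E]; rewrite sqn_cis in E.
- rewrite (sqn_0 z E) in *. now rewrite Cmult_0_l in HKc.
- now rewrite H, Cmult_1_r in HKc.
Qed.

Lemma twist_X z : X z -> X (twist z).
Proof.
apply cis_X. intros [E|E]; rewrite E.
- rewrite angle_1. apply cis_4PI.
- rewrite angle_4. apply cis_2PI.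
Qed.

Lemma twist_u0 : twist u0 = u0.
Proof. apply spin_fixes_bdD, u0_bdD. Qed.

Lemma sqn_bot : sqn bot = 9 / 4.
Proof. unfold sqn, bot. simpl. field. Qed.

Lemma twist_bot : twist bot = bot.
Proof.
unfold twist, spin. rewrite sqn_bot, angle_bot, cis_4PI. apply Cmult_1_r.
Qed.

(** The track of [z] while the rotation by [th] is deformed linearly into the twist; it starts at
    [z] as soon as [cis th = 1]. *)
Definition slide (th : R) (z : C) : path := fun s =>
  (z * cis (s * angle (4 * PI) (2 * PI) (sqn z) + (1 - s) * th))%C.

(* On the circles through points of [K] the constant angle [th] agrees with that
   of [twist], so the points of [K] are not met while one is deformed into the
   other. *)
Lemma twist_square th a b g : cis th = 1 -> is_path (X := X) a b g ->
  (forall t, I01 t -> sqn (g t) = 1 -> th = 4 * PI) ->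
  (forall t, I01 t -> sqn (g t) = 4 -> th = 2 * PI) ->
  phom (X := X) a (twist b) (g ** slide th b) (slide th a ** act twist g).
Proof.
intros Hth (Hc & HX & g0 & g1) H1 H4.
pose (H := fun z : C => slide th (g (snd z)) (fst z)).
assert (HH : forall s t, I01 s -> I01 t -> X (H (s, t))).
{ intros s t _ Ht. apply cis_X; [|now apply HX]. simpl.
  intros [E|E]; rewrite E.
  - rewrite angle_1, (H1 t Ht E).
    replace (s * (4 * PI) + (1 - s) * (4 * PI)) with (4 * PI) by ring.
    apply cis_4PI.
  - rewrite angle_4, (H4 t Ht E).
    replace (s * (2 * PI) + (1 - s) * (2 * PI)) with (2 * PI) by ring.
    apply cis_2PI. }
assert (Hcont : continuous_on (fun z : C => I01 (fst z) /\ I01 (snd z)) H).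
{ assert (continuous_on (fun z : C => I01 (fst z) /\ I01 (snd z))
    (fun z => g (snd z))).
  { apply cont_comp with (B := I01); auto; [cont|tauto]. }
  unfold H, slide, angle, lag1, lag2, sqn. cont. }
assert (P := phom_square (X := X) H Hcont HH).
assert (E0 : forall t, H (0, t) = g t).
{ intros t. unfold H, slide. simpl.
  rewrite Rmult_0_l, Rminus_0_r, Rmult_1_l, Rplus_0_l, Hth. apply Cmult_1_r. }
assert (E1 : forall t, H (1, t) = twist (g t)).
{ intros t. unfold H, slide, twist, spin. simpl.
  now rewrite Rmult_1_l, Rminus_diag, Rmult_0_l, Rplus_0_r. }
rewrite E0, E1, g0, g1 in P.
apply phom_trans with ((fun t => H (0, t)) ** (fun s => H (s, 1)));
  [apply phom_sym|apply phom_trans with (1 := P)]; apply phom_ext.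
- now apply phom_is_path_l in P.
- intros t _. unfold concat. rewrite E0. unfold H. simpl. now rewrite g1.
- now apply phom_is_path_r in P.
- intros t _. unfold concat. rewrite E1. unfold H. simpl. now rewrite g0.
Qed.

Lemma act_is_path a b g : twist a = a -> twist b = b ->
  is_path (X := X) a b g -> is_path (X := X) a b (act twist g).
Proof.
intros Ha Hb (Hc & HX & g0 & g1). unfold act. split; [|split; [|split]].
- unfold twist. apply cont_spin; [cont|cont|easy].
- intros t Ht. now apply twist_X, HX.
- now rewrite g0.
- now rewrite g1.
Qed.

Definition htwist {a b} (Ha : twist a = a) (Hb : twist b = b)
    (p : hpath X a b) : hpath X a b :=
  exist _ _ (act_is_path a b _ Ha Hb (proj2_sig p)).

#[global] Instance htwist_proper a b Ha Hb :
  Proper (heq ==> heq) (@htwist a b Ha Hb).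
Proof.
intros p q (H & Hc & HX & H0 & H1 & He). exists (fun z => twist (H z)).
split; [|split; [|split; [|split]]].
- unfold twist. apply cont_spin; [cont|cont|easy].
- intros s t Hs Ht. now apply twist_X, HX.
- intros t Ht. now rewrite H0.
- intros t Ht. now rewrite H1.
- intros s Hs. destruct (He s Hs) as [-> ->]. now rewrite Ha, Hb.
Qed.

Lemma htwist_comp a b c Ha Hb Hc (p : hpath X a b) (q : hpath X b c) :
  htwist Ha Hc (p ∙ q) ≃ htwist Ha Hb p ∙ htwist Hb Hc q.
Proof.
apply heq_ext. intros t _. simpl. unfold act, concat. now destruct Rle_dec.
Qed.

Lemma htwist_inv a b Ha Hb (p : hpath X a b) :
  htwist Hb Ha p⁻¹ ≃ (htwist Ha Hb p)⁻¹.
Proof. apply heq_ext. reflexivity. Qed.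

(** The angle at [u0] drops from 2 pi to 0, which is a clockwise turn. At [bot] it rises from 2 pi
    to 4 pi, whence the counterclockwise turn in [slide_bot]. *)
Lemma slide_u0 t : slide (2 * PI) u0 t = reverse (circle 0 u0) t.
Proof.
unfold slide, reverse, circle.
replace (sqn u0) with 16 by (unfold sqn, u0; simpl; ring).
rewrite angle_16. replace (t * 0 + (1 - t) * (2 * PI)) with (2 * PI * (1 - t)) by ring.
ring.
Qed.

Lemma slide_bot t : slide (2 * PI) bot t = circle 0 bot t.
Proof.
unfold slide, circle. rewrite sqn_bot, angle_bot.
replace (t * (4 * PI) + (1 - t) * (2 * PI)) with (2 * PI + 2 * PI * t) by ring.
rewrite cis_plus, cis_2PI. ring.
Qed.

Lemma slide_bot' t : slide (4 * PI) bot t = bot.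
Proof.
unfold slide. rewrite sqn_bot, angle_bot.
replace (t * (4 * PI) + (1 - t) * (4 * PI)) with (4 * PI) by ring.
rewrite cis_4PI. apply Cmult_1_r.
Qed.

Lemma htwist_outer (p : hpath X u0 u0) :
  (forall t, I01 t -> sqn (proj1_sig p t) <> 1) ->
  htwist twist_u0 twist_u0 p ≃ hbig ∙ (p ∙ hbig⁻¹).
Proof.
intros H.
assert (P := twist_square (2 * PI) u0 u0 (proj1_sig p) cis_2PI (proj2_sig p)).
rewrite twist_u0 in P.
assert (E : p ∙ hbig⁻¹ ≃ hbig⁻¹ ∙ htwist twist_u0 twist_u0 p).
{ eapply phom_trans; [|eapply phom_trans; [apply P|]].
  - apply phom_ext; [apply proj2_sig|]. intros t _. simpl. unfold concat.
    destruct Rle_dec; [easy|]. now rewrite slide_u0.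
  - now intros t Ht E%H.
  - easy.
  - apply phom_sym, phom_ext; [apply proj2_sig|]. intros t _. simpl.
    unfold concat. destruct Rle_dec; [|easy]. now rewrite slide_u0. }
now rewrite E, hcancel_r.
Qed.

(** The segment crosses |y| = 2 and stays off |y| = 1, so the angle 2 pi is admissible; the factors
    are the tracks of its two ends. *)
Lemma htwist_hdown :
  htwist twist_u0 twist_bot hdown ≃ hbig ∙ (hdown ∙ hsmall).
Proof.
assert (P := twist_square (2 * PI) u0 bot (proj1_sig hdown) cis_2PI (proj2_sig hdown)).
rewrite twist_bot in P.
assert (E : hdown ∙ hsmall ≃ hbig⁻¹ ∙ htwist twist_u0 twist_bot hdown).
{ eapply phom_trans; [|eapply phom_trans; [apply P|]].
  - apply phom_ext; [apply proj2_sig|]. intros t _. simpl. unfold concat.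
    destruct Rle_dec; [easy|]. now rewrite slide_bot.
  - intros t [Ht0 Ht1] E. exfalso. unfold sqn in E. simpl in E. nra.
  - easy.
  - apply phom_sym, phom_ext; [apply proj2_sig|]. intros t _. simpl.
    unfold concat. destruct Rle_dec; [|easy]. now rewrite slide_u0. }
now rewrite E, hcancel_r.
Qed.

(** Away from |y| = 2 the angle 4 pi is admissible. It agrees with the twist at [bot], so the base
    point does not move and no conjugation appears. *)
Lemma htwist_inner (p : hpath X bot bot) :
  (forall t, I01 t -> sqn (proj1_sig p t) <> 4) ->
  htwist twist_bot twist_bot p ≃ p.
Proof.
intros H.
assert (P := twist_square (4 * PI) bot bot (proj1_sig p) cis_4PI (proj2_sig p)).
rewrite twist_bot in P.
(* The homotopy supplies both the constant loop [o] as an [hpath] and the means to cancel it at the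
   end. *)
assert (Ho : phom (X := X) bot bot (proj1_sig (hsmall ∙ hsmall⁻¹)) (fun _ => bot))
  by apply phom_inv_r with bot, proj2_sig.
pose (o := exist _ _ (phom_is_path_r _ _ _ _ Ho) : hpath X bot bot).
assert (E : p ∙ o ≃ o ∙ htwist twist_bot twist_bot p).
{ eapply phom_trans; [|eapply phom_trans; [apply P|]].
  - apply phom_ext; [apply proj2_sig|]. intros t _. simpl. unfold concat.
    destruct Rle_dec; [easy|]. now rewrite slide_bot'.
  - easy.
  - now intros t Ht E%H.
  - apply phom_sym, phom_ext; [apply proj2_sig|]. intros t _. simpl.
    unfold concat. destruct Rle_dec; [|easy]. now rewrite slide_bot'. }
rewrite (hconst_l o) in E by easy. rewrite <- E.
assert (Eo : o ≃ hsmall ∙ hsmall⁻¹) by now apply phom_sym.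
rewrite Eo. apply hcancel_end.
Qed.

Lemma concat_forall (P : C -> Prop) (g h : path) :
  (forall t, I01 t -> P (g t)) -> (forall t, I01 t -> P (h t)) ->
  forall t, I01 t -> P ((g ** h) t).
Proof.
intros Hg Hh t [? ?]. unfold concat. destruct Rle_dec; [apply Hg|apply Hh];
  unfold I01; lra.
Qed.

Lemma reverse_forall (P : C -> Prop) (g : path) :
  (forall t, I01 t -> P (g t)) -> forall t, I01 t -> P (reverse g t).
Proof. intros Hg t [? ?]. apply Hg. unfold I01. lra. Qed.

Lemma hup'_inner j Hj t : I01 t -> sqn (proj1_sig (hup' j Hj) t) < 4.
Proof.
revert t. apply (concat_forall (fun z => sqn z < 4)); intros t [Ht0 Ht1];
  assert (0 <= t * (1 - t)) by (apply Rmult_le_pos; lra);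
  unfold sqn; destruct j as [|[|[|[|j]]]]; try lia; simpl; nra.
Qed.

Lemma hup_outer j t : (3 <= j)%nat -> I01 t -> 1 < sqn (proj1_sig (hup j) t).
Proof.
intros Hj. revert t.
apply (concat_forall (fun z => 1 < sqn z)); intros t [Ht0 Ht1];
  (* Along each leg [sqn] is quadratic with its minimum at 1/2 or at 64/73, which is close to 7/8;
     the two squares certify the bound. *)
  assert (0 <= (2 * t - 1) ^ 2) by apply pow2_ge_0;
  assert (0 <= (8 * t - 7) ^ 2) by apply pow2_ge_0;
  unfold sqn; destruct j as [|[|[|[|j]]]]; try lia; simpl; lra.
Qed.

(** * The relations *)

Definition gbase eps (He : 0 < eps < 1) i (Hi : (1 <= i <= 4)%nat) :
    hpath X u0 u0 :=
  exist _ _ (phom_is_path_l _ _ _ _ (gbase_hup eps i He Hi)).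

Lemma gbase_eq eps He i Hi : gbase eps He i Hi ≃ hup i ∙ (hup (i - 1))⁻¹.
Proof. exact (gbase_hup eps i He Hi). Qed.

Lemma index1 : (1 <= 1 <= 4)%nat. Proof. lia. Qed.
Lemma index2 : (1 <= 2 <= 4)%nat. Proof. lia. Qed.
Lemma index3 : (1 <= 3 <= 4)%nat. Proof. lia. Qed.
Lemma index4 : (1 <= 4 <= 4)%nat. Proof. lia. Qed.

Lemma htwist_gbase_4 eps He : htwist twist_u0 twist_u0 (gbase eps He 4 index4) ≃
  hbig ∙ (gbase eps He 4 index4 ∙ hbig⁻¹).
Proof.
rewrite gbase_eq. apply htwist_outer. intros t Ht.
apply Rgt_not_eq. revert t Ht.
apply (concat_forall (fun z => 1 < sqn z));
  [|apply (reverse_forall (fun z => 1 < sqn z))];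
  intros t; apply hup_outer; simpl; lia.
Qed.

(** The generator is [hdown ∙ l ∙ hdown⁻¹] with [l] inside |y| < 2. The twist keeps [l] and sends
    [hdown] to [hbig ∙ hdown ∙ hsmall], which is [hbig ∙ A ∙ hdown]. *)
Lemma htwist_gbase_inner eps He i Hi : (i <= 3)%nat ->
  let A := hdown ∙ hsmall ∙ hdown⁻¹ in
  htwist twist_u0 twist_u0 (gbase eps He i Hi) ≃
  hbig ∙ A ∙ gbase eps He i Hi ∙ (hbig ∙ A)⁻¹.
Proof.
intros Hi3 A. rewrite gbase_eq.
assert (Hi3' : (i - 1 <= 3)%nat) by lia.
pose (l := hup' i Hi3 ∙ (hup' (i - 1) Hi3')⁻¹).
assert (E : hup i ∙ (hup (i - 1))⁻¹ ≃ hdown ∙ l ∙ hdown⁻¹).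
{ unfold l. now rewrite (hup_hup' i Hi3), (hup_hup' _ Hi3'), hinv_comp, !hassoc. }
rewrite E, (htwist_comp _ _ _ twist_u0 twist_bot twist_u0),
  (htwist_comp _ _ _ twist_u0 twist_bot twist_bot), (htwist_inv _ _ twist_u0 twist_bot).
rewrite htwist_inner, htwist_hdown.
- unfold A. rewrite !hinv_comp, !hinv_inv, !hassoc, !hcancel_l. reflexivity.
- intros t Ht. apply Rlt_not_eq. revert t Ht.
  apply (concat_forall (fun z => sqn z < 4));
    [|apply (reverse_forall (fun z => sqn z < 4))];
    intros t; apply hup'_inner.
Qed.

(** The product of the factors [hup i ∙ (hup (i - 1))⁻¹] telescopes. *)
Lemma hsmall_gbase eps He : hdown ∙ hsmall ∙ hdown⁻¹ ≃
  gbase eps He 3 index3 ∙ gbase eps He 2 index2 ∙ gbase eps He 1 index1.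
Proof.
now rewrite hsmall_hup, !gbase_eq, !hassoc, !hcancel_l.
Qed.

Lemma hbig_gbase eps He : hbig ≃ gbase eps He 4 index4 ∙
  (gbase eps He 3 index3 ∙ gbase eps He 2 index2 ∙ gbase eps He 1 index1).
Proof.
now rewrite hbig_hup, !gbase_eq, !hassoc, !hcancel_l.
Qed.

(** * Congruence modulo a normal closure, and the equivalence of the relations *)

Section NormalClosure.
Context {Y : C -> Prop} {u : C} (Eq : path -> path -> Prop).

(** Equality in the quotient of the fundamental group by the normal closure. As a congruence coarser
    than [≃] it allows relations to be used for rewriting. *)
Definition nc_eq (p q : hpath Y u u) : Prop :=
  normal_closure Y u Eq (proj1_sig (p ∙ q⁻¹)).

Lemma nc_heq (p q : hpath Y u u) :
  p ≃ q -> normal_closure Y u Eq (proj1_sig p) ->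
  normal_closure Y u Eq (proj1_sig q).
Proof. intros H Hp. exact (nc_homotopic _ _ _ _ _ Hp H). Qed.

#[global] Instance nc_eq_subrelation : subrelation heq nc_eq.
Proof.
intros p q H. unfold nc_eq. apply nc_homotopic with (fun _ => u).
- apply nc_one.
- change (phom (X := Y) u u (fun _ => u) (proj1_sig (p ∙ q⁻¹))).
  apply phom_sym. apply phom_trans with (proj1_sig (q ∙ q⁻¹)).
  + change (p ∙ q⁻¹ ≃ q ∙ q⁻¹). now rewrite H.
  + apply phom_inv_r with u, proj2_sig.
Qed.

#[global] Instance nc_eq_equiv : Equivalence nc_eq.
Proof.
split.
- intros p. apply nc_eq_subrelation. reflexivity.
- intros p q H. apply nc_inv in H. apply (nc_heq (p ∙ q⁻¹)⁻¹); [|exact H].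
  now rewrite hinv_comp, hinv_inv.
- intros p q r H1 H2.
  apply (nc_heq ((p ∙ q⁻¹) ∙ (q ∙ r⁻¹))); [|now apply nc_mul].
  now rewrite hassoc, hcancel_l.
Qed.

#[global] Instance nc_eq_comp : Proper (nc_eq ==> nc_eq ==> nc_eq) (@hcomp Y u u u).
Proof.
intros p p' Hp q q' Hq.
(* Normality enters here: the quotient of the products is a conjugate of [q ∙ q'⁻¹] times
   [p ∙ p'⁻¹]. *)
apply (nc_heq ((p ∙ (q ∙ q'⁻¹) ∙ p⁻¹) ∙ (p ∙ p'⁻¹))).
- now rewrite !hassoc, hcancel_l, hinv_comp.
- apply nc_mul; [|exact Hp]. apply nc_conj; [apply proj2_sig|exact Hq].
Qed.

Lemma nc_eq_cancel_l (p q r : hpath Y u u) : nc_eq (p ∙ q) (p ∙ r) -> nc_eq q r.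
Proof.
intros H. rewrite <- (hcancel_l p q), <- (hcancel_l p r). now rewrite H.
Qed.

Lemma nc_eq_conj (p q : hpath Y u u) : nc_eq (p ∙ q ∙ p⁻¹) q <-> nc_eq (p ∙ q) (q ∙ p).
Proof.
split; intros H.
- rewrite <- H at 2. rewrite !hassoc.
  rewrite <- (hinv_inv p) at 4. now rewrite hcancel_end.
- rewrite H, hassoc. now rewrite hcancel_end.
Qed.

(** With W = A A x4, the last two displayed relations say W x3 = x3 W and W x3 x2 = x3 x2 W, hence
    that W commutes with x3 and x2. It also commutes with A = x3 x2 x1, and so with x1. *)
Lemma relations_equiv (x1 x2 x3 x4 A B : hpath Y u u) :
  A ≃ x3 ∙ x2 ∙ x1 -> B ≃ x4 ∙ (x3 ∙ x2 ∙ x1) ->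
  (nc_eq (B ∙ x4 ∙ B⁻¹) x4 /\
   nc_eq (B ∙ A ∙ x1 ∙ (B ∙ A)⁻¹) x1 /\
   nc_eq (B ∙ A ∙ x2 ∙ (B ∙ A)⁻¹) x2 /\
   nc_eq (B ∙ A ∙ x3 ∙ (B ∙ A)⁻¹) x3)
  <->
  (nc_eq (x4 ∙ x3 ∙ x2 ∙ x1) (x3 ∙ x2 ∙ x1 ∙ x4) /\
   nc_eq ((x3 ∙ x2 ∙ x1) ∙ (x3 ∙ x2 ∙ x1) ∙ x4)
     (x2 ∙ x1 ∙ x3 ∙ x2 ∙ x1 ∙ x4 ∙ x3) /\
   nc_eq (x2 ∙ x1 ∙ x3 ∙ x2 ∙ x1 ∙ x4 ∙ x3)
     (x1 ∙ x3 ∙ x2 ∙ x1 ∙ x4 ∙ x3 ∙ x2)).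
Proof.
intros EA EB. rewrite <- EA in EB. rewrite !nc_eq_conj.
(* The existential makes [W] an atom that reassociation cannot open. *)
assert (EW : exists W, W ≃ A ∙ A ∙ x4) by (eexists; reflexivity).
destruct EW as [W EW].
assert (E1 : x4 ∙ x3 ∙ x2 ∙ x1 ≃ x4 ∙ A) by (rewrite EA, !hassoc; reflexivity).
assert (E2 : x2 ∙ x1 ∙ x3 ∙ x2 ∙ x1 ∙ x4 ∙ x3 ≃ x2 ∙ (x1 ∙ (A ∙ (x4 ∙ x3))))
  by (rewrite EA, !hassoc; reflexivity).
assert (E3 : x1 ∙ x3 ∙ x2 ∙ x1 ∙ x4 ∙ x3 ∙ x2 ≃ x1 ∙ (A ∙ (x4 ∙ (x3 ∙ x2))))
  by (rewrite EA, !hassoc; reflexivity).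
(* Multiplying the second word by [x3], or the third by [x3 ∙ x2], on the left completes a factor
   [A], so that [W] appears. *)
assert (F2 : x3 ∙ (x2 ∙ (x1 ∙ (A ∙ (x4 ∙ x3)))) ≃ W ∙ x3)
  by (rewrite EW, EA, !hassoc; reflexivity).
assert (F3 : x3 ∙ (x2 ∙ (x1 ∙ (A ∙ (x4 ∙ (x3 ∙ x2))))) ≃ W ∙ (x3 ∙ x2))
  by (rewrite EW, EA, !hassoc; reflexivity).
rewrite E1, E2, E3, <- EA, <- EW.
assert (BA : nc_eq (x4 ∙ A) (A ∙ x4) -> nc_eq (B ∙ A) W).
{ intros H. rewrite EW, EB, H, !hassoc. now rewrite H. }
split.
- intros (H4 & H1 & H2 & H3).
  (* As B = x4 A, commutation of B and x4 reads x4 A x4 = x4 x4 A, and x4 cancels. *)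
  assert (R1 : nc_eq (x4 ∙ A) (A ∙ x4)).
  { symmetry. apply (nc_eq_cancel_l x4). rewrite <- hassoc, <- EB. exact H4. }
  rewrite (BA R1) in H1, H2, H3.
  assert (R2 : nc_eq W (x2 ∙ (x1 ∙ (A ∙ (x4 ∙ x3))))).
  { apply (nc_eq_cancel_l x3). rewrite F2. now symmetry. }
  split; [exact R1|split; [exact R2|]]. rewrite <- R2.
  apply (nc_eq_cancel_l x2), (nc_eq_cancel_l x3).
  rewrite F3, <- H2, <- !hassoc, H3. reflexivity.
- intros (R1 & R2 & R3). rewrite <- R2 in R3.
  assert (H3 : nc_eq (W ∙ x3) (x3 ∙ W)) by (rewrite <- F2, <- R2; reflexivity).
  assert (H2 : nc_eq (W ∙ x2) (x2 ∙ W)).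
  { apply (nc_eq_cancel_l x3). rewrite <- hassoc, <- H3, hassoc, <- F3.
    now rewrite <- R3. }
  assert (HA : nc_eq (W ∙ A) (A ∙ W)).
  { rewrite EW, !hassoc, R1. reflexivity. }
  assert (H1 : nc_eq (W ∙ x1) (x1 ∙ W)).
  { apply (nc_eq_cancel_l x2), (nc_eq_cancel_l x3).
    rewrite <- (hassoc x2 x1 W), <- (hassoc x3 (x2 ∙ x1)), <- (hassoc x3 x2 x1).
    rewrite <- EA, <- HA, EA, !hassoc.
    rewrite <- (hassoc x2 W), <- H2, hassoc.
    rewrite <- (hassoc x3 W), <- H3, hassoc. reflexivity. }
  rewrite (BA R1). split; [|auto].
  rewrite EB, !hassoc, <- R1. reflexivity.
Qed.

End NormalClosure.

Lemma normal_closure_incl (Y : C -> Prop) u (Eq1 Eq2 : path -> path -> Prop) g :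
  (forall l r, Eq1 l r -> normal_closure Y u Eq2 (l ** reverse r)) ->
  normal_closure Y u Eq1 g -> normal_closure Y u Eq2 g.
Proof.
intros H Hg. induction Hg; eauto using normal_closure.
Qed.

Theorem theorem5p3 (eps : R) (Heps : 0 < eps < 1) :
  is_braid K (local_braid_monodromy curve 4) /\
  (forall f : C -> C,
     local_braid_monodromy curve 4 f <-> motion_braid K 4 twist_motion f) /\
  (forall beta : C -> C, local_braid_monodromy curve 4 beta ->
     let x := fun i : nat => gbase_loop eps (RtoC (pt i)) in
     let x1 := x 1%nat in let x2 := x 2%nat in
     let x3 := x 3%nat in let x4 := x 4%nat in
     same_normal_closure (complement K) u0
       (induced_relations 4 x beta)
       (fun l r : path => In (l, r)
          [ (x4 ** x3 ** x2 ** x1, x3 ** x2 ** x1 ** x4);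
            ((x3 ** x2 ** x1) ** (x3 ** x2 ** x1) ** x4,
             x2 ** x1 ** x3 ** x2 ** x1 ** x4 ** x3);
            (x2 ** x1 ** x3 ** x2 ** x1 ** x4 ** x3,
             x1 ** x3 ** x2 ** x1 ** x4 ** x3 ** x2) ])).
Proof.
split; [|split].
- exists twist. split; [apply twist_braid_diffeo|apply local_monodromy_twist].
- intros f. now rewrite local_monodromy_twist, twist_motion_twist.
- intros beta Hbeta x x1 x2 x3 x4.
  apply local_monodromy_twist in Hbeta. destruct Hbeta as [_ Hbeta].
  set (Eq1 := induced_relations 4 x beta).
  set (Eq2 := fun l r : path => In (l, r) _).
  pose (X1 := gbase eps Heps 1 index1). pose (X2 := gbase eps Heps 2 index2).
  pose (X3 := gbase eps Heps 3 index3). pose (X4 := gbase eps Heps 4 index4).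
  assert (Hx : forall i Hi, x i = proj1_sig (gbase eps Heps i Hi)) by easy.
  (* Only the automorphism induced by [beta] is known, so [beta] is exchanged for the twist inside
     each relator by a homotopy. *)
  assert (Hb : forall Eq i Hi,
    normal_closure X u0 Eq (act beta (x i) ** reverse (x i)) <->
    nc_eq Eq (htwist twist_u0 twist_u0 (gbase eps Heps i Hi)) (gbase eps Heps i Hi)).
  { intros Eq i Hi. unfold nc_eq. simpl.
    assert (P := is_path_reverse (X := X) _ _ _ (proj2_sig (gbase eps Heps i Hi))).
    assert (Hh := Hbeta (x i) (proj2_sig (gbase eps Heps i Hi))).
    split; intros H; refine (nc_homotopic _ _ _ _ _ H _);
      apply (phom_concat u0 u0 u0); try (now apply phom_refl).
    - now apply phom_sym.
    - exact Hh. }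
  assert (T1 := htwist_gbase_inner eps Heps 1 index1 ltac:(lia)).
  assert (T2 := htwist_gbase_inner eps Heps 2 index2 ltac:(lia)).
  assert (T3 := htwist_gbase_inner eps Heps 3 index3 ltac:(lia)).
  assert (T4 := htwist_gbase_4 eps Heps). cbv zeta in T1, T2, T3.
  rewrite <- hassoc in T4.
  assert (Q := fun Eq => relations_equiv Eq X1 X2 X3 X4 _ _
    (hsmall_gbase eps Heps) (hbig_gbase eps Heps)).
  intros g _. split; apply normal_closure_incl.
  + intros l r (j & Hj & -> & ->). apply (Hb Eq2 j Hj).
    assert (R := proj2 (Q Eq2)).
    destruct R as (R4 & R1 & R2 & R3).
    { split; [|split]; apply nc_relator; unfold Eq2; simpl; auto. }
    destruct j as [|[|[|[|[|j]]]]]; try lia.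
    * change (nc_eq Eq2 (htwist twist_u0 twist_u0 X1) X1).
      unfold X1. rewrite T1. exact R1.
    * change (nc_eq Eq2 (htwist twist_u0 twist_u0 X2) X2).
      unfold X2. rewrite T2. exact R2.
    * change (nc_eq Eq2 (htwist twist_u0 twist_u0 X3) X3).
      unfold X3. rewrite T3. exact R3.
    * change (nc_eq Eq2 (htwist twist_u0 twist_u0 X4) X4).
      unfold X4. rewrite T4. exact R4.
  + assert (N : forall i Hi, nc_eq Eq1
      (htwist twist_u0 twist_u0 (gbase eps Heps i Hi)) (gbase eps Heps i Hi)).
    { intros i Hi. apply Hb, nc_relator. now exists i. }
    assert (N1 := N 1%nat index1). assert (N2 := N 2%nat index2).
    assert (N3 := N 3%nat index3). assert (N4 := N 4%nat index4).
    rewrite T1 in N1. rewrite T2 in N2. rewrite T3 in N3. rewrite T4 in N4.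
    destruct (proj1 (Q Eq1) (conj N4 (conj N1 (conj N2 N3)))) as (R1 & R2 & R3).
    intros l r [E|[E|[E|[]]]]; injection E as <- <-; assumption.
Qed.
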